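(* Let $r\ge1$ and let $\mathcal P_r$ be the set of partitions with at most $r$ parts. Then $$\sum_{d\ge0}\frac{t^d}{d!}\sum_{\boldsymbol\lambda\in\mathcal P_r,\ |\boldsymbol\lambda|=d}f^{\boldsymbol\lambda}s_{\boldsymbol\lambda}(z_1,\ldots,z_r)=\exp\big(t(z_1+\cdots+z_r)\big).$$ As a consequence, for each $d\ge0$, $$(z_1+\cdots+z_r)^d=\sum_{\boldsymbol\lambda\in\mathcal P_r,\ |\boldsymbol\lambda|=d}f^{\boldsymbol\lambda}s_{\boldsymbol\lambda}(z_1,\ldots,z_r).$$
   Context: A partition is a non-increasing sequence $\boldsymbol\lambda=(\lambda_1\ge\lambda_2\ge\cdots)$ of non-negative integers with finitely many nonzero terms; $|\boldsymbol\lambda|=\sum_i\lambda_i$. For $\boldsymbol\lambda\in\mathcal P_r$, $s_{\boldsymbol\lambda}(z_1,\ldots,z_r)$ is the Schur symmetric polynomial in the $r$ indeterminates $z_1,\ldots,z_r$: $$s_{\boldsymbol\lambda}(z_1,\ldots,z_r)=\frac{\det\big(z_i^{\lambda_j+r-j}\big)_{1\le i,j\le r}}{\det\big(z_i^{r-j}\big)_{1\le i,j\le r}}.$$ $f^{\boldsymbol\lambda}$ is the Plücker degree of the Schubert variety of dimension $|\boldsymbol\lambda|$ associated to $\boldsymbol\lambda$: if $\boldsymbol\lambda$ has at most $r$ parts and $\lambda_1\le n-r$, and $F_1\subsetneq\cdots\subsetneq F_r\subseteq\mathbb C^n$ is a flag of subspaces with $\dim F_i=i+\lambda_{r+1-i}$,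 then $f^{\boldsymbol\lambda}$ is the degree, in the Plücker embedding of the Grassmannian $G(r,n)$ of $r$-dimensional subspaces of $\mathbb C^n$, of $\{\Lambda\in G(r,n)\mid\dim(\Lambda\cap F_i)\ge i,\ 1\le i\le r\}$. It does not depend on the choice of $r,n$, and it equals the number of standard Young tableaux of shape $\boldsymbol\lambda$. *)

(* Defs.v *)
From HB Require Import structures.
From mathcomp Require Import all_boot all_order all_algebra.
From mathcomp Require Import fraction complex mpoly.
From mathcomp Require Import boolp classical_sets reals.

Set Implicit Arguments.
Unset Strict Implicit.
Unset Printing Implicit Defensive.

Import Order.TTheory GRing.Theory Num.Theory.
Local Open Scope ring_scope.

(* A partition is a non-increasing [l : seq nat]; its (i+1)-st part is
   [nth 0 l i], so trailing zeros are irrelevant.  A member of P_r is listed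
   below as the non-increasing sequence of its r first parts; the parts of a
   partition of d are at most d, hence the type ['I_d.+1]. *)
Definition partitions (r d : nat) : seq (seq nat) :=
  [seq l <- [seq map val t | t : r.-tuple 'I_d.+1] |
     sorted geq l && (sumn l == d)].

Section Schur.
Variable r : nat.

(* the field of rational functions Q(z_1, ..., z_r) *)
Definition ratfun := {fraction {mpoly rat[r]}}.

Definition z (i : 'I_r) : ratfun := tofrac ('X_i : {mpoly rat[r]}).

(* Rows and columns are numbered from 0: lambda_j + r - j is
   [nth 0 l j + (r - j.+1)].  The denominator is a Vandermonde determinant in
   distinct indeterminates, hence nonzero. *)
Definition schur (l : seq nat) : ratfun :=
  \det (\matrix_(i < r, j < r) z i ^+ (nth 0 l j + (r - j.+1))%N) /
  \det (\matrix_(i < r, j < r) z i ^+ (r - j.+1)%N).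
End Schur.

(* Formal power series in t, as sequences of coefficients. *)
Section PowerSeries.
Variable A : fieldType.
Implicit Types F G c : nat -> A.

Definition series_one : nat -> A := fun d => (d == 0%N)%:R.

Definition series_mul F G : nat -> A :=
  fun d => \sum_(k < d.+1) F k * G (d - k)%N.

Definition series_pow F (k : nat) : nat -> A := iter k (series_mul F) series_one.

(* exp(F) = sum_k F^k / k!, for F without constant term: F^k has order at
   least k, so that only k <= d contributes to the coefficient of t^d. *)
Definition series_exp F : nat -> A :=
  fun d => \sum_(k < d.+1) series_pow F k d / k`!%:R.

(* the series a t *)
Definition series_linear (a : A) : nat -> A :=
  fun d => if d == 1%N then a else 0.

(* the series sum_d (t^d / d!) c_d *)
Definition series_egf c : nat -> A := fun d => c d / d`!%:R.
End PowerSeries.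

Section Degree.
Variables (K : fieldType) (N : nat).

(* A subset X of the projective space of dimension N - 1 is given by a set of
   homogeneous coordinate vectors, at least one for each of its points; whether
   a form vanishes at a point does not depend on the vector chosen. *)
Variable X : set ('I_N -> K).

Definition vanishes_on (p : {mpoly K[N]}) : Prop := forall v, X v -> p.@[v] = 0.

(* The degree m part S_m / I(X)_m of the homogeneous coordinate ring of X has
   dimension h: the classes of some forms b_1, ..., b_h are a basis of it. *)
Definition hilbert_function (m h : nat) : Prop :=
  exists b : 'I_h -> {mpoly K[N]},
    (forall i, b i \is m.-homog) /\
    forall p : {mpoly K[N]}, p \is m.-homog ->
      exists! c : 'rV[K]_h, vanishes_on (p - \sum_(i < h) c 0 i *: b i).

Definition hilbert_polynomial (P : {poly rat}) : Prop :=
  exists m0 : nat, forall m : nat, (m0 <= m)%N ->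
    exists2 h : nat, hilbert_function m h & P.[m%:R] = h%:R.

(* (dim X)! times the leading coefficient of the Hilbert polynomial, whose
   degree is dim X. *)
Definition has_degree (D : nat) : Prop :=
  exists2 P : {poly rat}, hilbert_polynomial P &
    D%:R = (size P).-1`!%:R * lead_coef P.
End Degree.

(* Subspaces of K^n are row spaces of matrices; a point of G(r, n) is given by
   an r x n matrix of rank r, whose rows are a basis of it. *)
Section Schubert.
Variables (K : fieldType) (r n : nat).

(* the sets of r columns, listed increasingly: they index the coordinates of
   the r-th exterior power of K^n *)
Definition columns : {set r.-tuple 'I_n} :=
  [set I : r.-tuple 'I_n | sorted ltn (map val I)].

Definition plucker (M : 'M[K]_(r, n)) : 'I_#|columns| -> K :=
  fun k => \det (colsub (tnth (enum_val k)) M).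

(* dim F_i = i + lambda_{r+1-i}; here F_{i+1} is [F i] *)
Definition is_flag (l : seq nat) (F : 'I_r -> 'M[K]_n) : Prop :=
  (forall i : 'I_r, \rank (F i) = (i.+1 + nth 0 l (r - i.+1))%N) /\
  (forall i j : 'I_r, (i < j)%N -> (F i < F j)%MS).

(* the image in the Pluecker embedding of the Schubert variety of F *)
Definition schubert (F : 'I_r -> 'M[K]_n) : set ('I_#|columns| -> K) :=
  fun v => exists M : 'M[K]_(r, n),
    [/\ row_free M,
        forall i : 'I_r, (i < \rank (M :&: F i)%MS)%N &
        v = plucker M].
End Schubert.

(* D is the degree of the Schubert variety obtained from some choice of r, n
   and of a flag F. *)
Definition is_plucker_degree (K : fieldType) (l : seq nat) (D : nat) : Prop :=
  exists r n : nat, exists F : 'I_r -> 'M[K]_n,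
    [/\ (0 < r)%N /\ (forall i, (r <= i)%N -> nth 0%N l i = 0%N),
        (nth 0 l 0 + r <= n)%N,
        is_flag l F &
        has_degree (schubert F) D].

(* The number f^lambda.  All choices of r, n and F give the same degree, so
   that [xget] picks the only possible value. *)
Definition plucker_degree (K : fieldType) (l : seq nat) : nat :=
  xget 0%N (is_plucker_degree K l).

(* Main.v *)
Require Import Defs.
From mathcomp Require Import all_boot all_order all_algebra.
From mathcomp Require Import perm.
From mathcomp Require Import fraction complex mpoly.
From mathcomp Require Import boolp classical_sets reals.
From mathcomp Require Import zify.

Set Implicit Arguments.
Unset Strict Implicit.
Unset Printing Implicit Defensive.

Import Order.TTheory GRing.Theory Num.Theory.
Local Open Scope ring_scope.

(** Hodge's standard monomial theory computes the Hilbert function of a Schubert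
variety.  In a basis adapted to the flag, the variety with index w is the image
of the linear space of r x n matrices L with L i t = 0 for t > w_i.  A product of
Pluecker coordinates is standard if their indices form a chain for the
componentwise order.  Straightening shows that standard monomials of degree m
span the forms of degree m; those whose largest index is not below w vanish on
the variety, and the others are independent there, by restriction to smaller
Schubert varieties.  Hence the Hilbert function at m counts the multichains of
length m below w, which is the sum over k of the number of strict chains of
length k below w times binomial(m, k).  So the degree is the number of saturated
chains below w, that is, of standard tableaux.  The identity then
follows by iterating the Pieri rule for multiplication by z_1 + ... + z_r, applied
to the numerators of the Schur polynomials. *)

(** * Standard Young tableaux and Schur polynomials *)

Definition decr (mu : nat -> nat) (i : nat) : nat -> nat :=
  fun k => (mu k - (k == i))%N.

(* The number of standard tableaux of shape mu, where mu is a partition of d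
   with at most N parts. *)
Fixpoint nsyt (N d : nat) (mu : nat -> nat) : nat :=
  if d is d'.+1 then \sum_(i < N | (mu i.+1 < mu i)%N) nsyt N d' (decr mu i)
  else 1%N.

Lemma nsyt_widen N M d mu : (N <= M)%N -> (forall i, (N <= i)%N -> mu i = 0%N) ->
  nsyt N d mu = nsyt M d mu.
Proof.
move=> leNM; elim: d mu => //= d IHd mu mu0.
rewrite (big_ord_widen_cond M (fun i => (mu i.+1 < mu i)%N)
  (fun i => nsyt N d (decr mu i)) leNM).
apply: eq_big => [i | i _].
  by case: (ltnP i N) => leNi; rewrite ?andbT ?andbF // (mu0 i leNi).
by apply: IHd => k /mu0 mu_k; rewrite /decr mu_k.
Qed.

Lemma nsyt_bound N M d mu :
  (forall i, (N <= i)%N -> mu i = 0%N) -> (forall i, (M <= i)%N -> mu i = 0%N) ->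
  nsyt N d mu = nsyt M d mu.
Proof.
by move=> N0 M0; case: (leqP N M) => [|/ltnW] le; [|symmetry]; apply: nsyt_widen.
Qed.

(** The last nonzero row ends in a removable corner, so induction produces a tableau. Positivity
    later fixes the degree of the Hilbert polynomial. *)
Lemma nsyt_gt0 N d mu : (forall i, (mu i.+1 <= mu i)%N) ->
  (forall i, (N <= i)%N -> mu i = 0%N) -> (\sum_(i < N) mu i)%N = d ->
  (0 < nsyt N d mu)%N.
Proof.
elim: d mu => //= d IHd mu mu_ni mu0 sum_mu.
have ex_i : exists i : nat, (0 < mu i)%N.
  apply: contrapT => /forallNP mu_eq0.
  move: sum_mu; rewrite big1 // => i _; apply/eqP; rewrite -leqn0 leqNgt.
  by apply/negP/mu_eq0.
have bnd i : (0 < mu i)%N -> (i <= N)%N.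
  by case: (leqP i N) => // /ltnW /mu0 ->.
case: (ex_maxnP ex_i bnd) => i mui imax.
have mui1 : mu i.+1 = 0%N.
  by apply/eqP; rewrite -leqn0 leqNgt; apply/negP => /imax; rewrite ltnn.
have ltiN : (i < N)%N by rewrite ltnNge; apply/negP => /mu0; lia.
rewrite (bigD1 (Ordinal ltiN)) /= ?mui1 // addn_gt0 IHd //.
- move=> k; rewrite /decr; have := mu_ni k.
  by case: (eqVneq k i) => [->|]; rewrite ?mui1; lia.
- by move=> k /mu0; rewrite /decr => ->.
move: sum_mu; rewrite (bigD1 (Ordinal ltiN)) //= => sum_mu.
rewrite (bigD1 (Ordinal ltiN)) //= {1}/decr eqxx.
rewrite (eq_bigr (fun k : 'I_N => mu k)); first by lia.
by move=> k; rewrite -val_eqE /= /decr => /negPf ->; rewrite subn0.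
Qed.

Lemma mem_partitions r d l : (l \in partitions r d) =
  [&& size l == r, sorted geq l & sumn l == d].
Proof.
rewrite mem_filter andbC.
case: (boolP (sorted geq l && (sumn l == d))) => [/andP[sl /eqP sd] | ]; last first.
  by rewrite andbF andbF.
rewrite andbT andbT; apply/mapP/eqP => [[t _ ->] | szl]; first by rewrite size_map size_tuple.
have ledx : all (fun x => x < d.+1)%N l.
  apply/allP => x xl; rewrite ltnS -sd.
  by elim: (l) xl => //= y s IHs; rewrite inE => /orP[/eqP <-|/IHs]; lia.
have size_t : size (map (inord : nat -> 'I_d.+1) l) == r by rewrite size_map szl.
exists (Tuple size_t); first by rewrite mem_enum.
rewrite /= -map_comp -[LHS]map_id; apply/eq_in_map => x /(allP ledx) /= xd.
by rewrite inordK.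
Qed.

Lemma partitions_uniq r d : uniq (partitions r d).
Proof.
rewrite filter_uniq // map_inj_uniq ?enum_uniq // => t u.
by move=> /inj_map tu; apply/val_inj/tu/val_inj.
Qed.

Lemma sorted_geqP l : reflect (forall i, nth 0%N l i.+1 <= nth 0%N l i)%N (sorted geq l).
Proof.
apply: (iffP (sortedP 0%N)) => H i; last by move=> _; apply: H.
by case: (ltnP i.+1 (size l)) => [/H //|le]; rewrite nth_default.
Qed.

Lemma sumn_incr_nth l i : sumn (incr_nth l i) = (sumn l).+1.
Proof.
elim: l i => [|y l IHl] [|i] //=; last by rewrite IHl addnS.
by rewrite sumn_ncons mul0n.
Qed.

(** A box may be added to row [k] when the row above is strictly longer; quantifying over [i] with
    [i.+1 == k] leaves the first row unconstrained. Once added, the box is a removable corner, which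
    is the condition on the right. *)
Lemma mem_partitions_incr r d l (k : 'I_r) : size l = r ->
  (l \in partitions r d) && [forall i : 'I_r, (i.+1 == k) ==> (nth 0 l k < nth 0 l i)%N] =
  (incr_nth l k \in partitions r d.+1) && (nth 0 (incr_nth l k) k.+1 < nth 0 (incr_nth l k) k)%N.
Proof.
move=> szl; have kl : (k < size l)%N by rewrite szl.
rewrite !mem_partitions size_incr_nth kl szl eqxx /= sumn_incr_nth eqSS.
case: (sumn l == d); rewrite ?andbF ?andbT //.
apply/andP/andP => [[/sorted_geqP sl /forallP add_k] | [/sorted_geqP sl]].
  split; last by rewrite !nth_incr_nth eqxx; have := sl k; lia.
  apply/sorted_geqP => i; rewrite !nth_incr_nth; have := sl i.
  case: (ltnP i r) => [ltir | leri]; last by rewrite !nth_default ?szl; lia.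
  have /implyP /= := add_k (Ordinal ltir).
  case: (eqVneq i.+1 k) => [-> /(_ isT)| ]; lia.
rewrite !nth_incr_nth => rem_k; split.
  apply/sorted_geqP => i; have := sl i; rewrite !nth_incr_nth.
  case: (eqVneq (k : nat) i) rem_k => [<- | ]; lia.
apply/forallP => i; apply/implyP => /eqP ik; have := sl i.
by rewrite !nth_incr_nth -ik; lia.
Qed.

Lemma decr_incr_nth l k : decr (nth 0%N (incr_nth l k)) k = nth 0%N l.
Proof. by apply/funext => i; rewrite /decr nth_incr_nth eq_sym; lia. Qed.

(** Adding and removing a box in row [k] are inverse to each other. This turns a sum over boxes
    addable to partitions of d into a sum over corners of partitions of d + 1, as in the recursion
    of [nsyt]. *)
Lemma partitions_incr r d (k : 'I_r) :
  perm_eq [seq incr_nth l k | l <- partitions r d &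
            [forall i : 'I_r, (i.+1 == k) ==> (nth 0 l k < nth 0 l i)%N]]
          [seq l <- partitions r d.+1 | (nth 0 l k.+1 < nth 0 l k)%N].
Proof.
apply: uniq_perm; last 1 first.
- move=> l; rewrite mem_filter andbC.
  apply/mapP/andP => [[l' l'P ->] | [lP rem_k]].
    move: l'P; rewrite mem_filter andbC => l'P; apply/andP.
    rewrite -mem_partitions_incr //.
    by move: l'P => /andP[]; rewrite mem_partitions => /and3P[/eqP].
  have szl : size l = r by move: lP; rewrite mem_partitions => /and3P[/eqP].
  have kl : (k < size l)%N by rewrite szl.
  pose l' := set_nth 0%N l k (nth 0%N l k).-1.
  have szl' : size l' = r by rewrite size_set_nth szl; apply/maxn_idPr.
  have ll' : l = incr_nth l' k.
    apply: (@eq_from_nth _ 0%N); first by rewrite size_incr_nth szl' ltn_ord.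
    move=> i _; rewrite nth_incr_nth nth_set_nth /=.
    by case: (eqVneq i (k : nat)) => [-> | ]; lia.
  exists l' => //; rewrite mem_filter andbC mem_partitions_incr // -ll' lP //.
- rewrite map_inj_in_uniq; first exact/filter_uniq/partitions_uniq.
  move=> l l'.
  rewrite [l \in _]mem_filter [l' \in _]mem_filter !mem_partitions.
  move=> /and4P[_ /eqP szl _ _] /and4P[_ /eqP szl' _ _] /(congr1 (fun l => nth 0%N l)) eq_l.
  apply: (@eq_from_nth _ 0%N) => [|i _]; first by rewrite szl szl'.
  by have := congr1 (fun f => f i) eq_l; rewrite /= !nth_incr_nth; lia.
- exact/filter_uniq/partitions_uniq.
Qed.

(** * Alternants and the Pieri rule *)

Section Alternants.
Variables (A : comNzRingType) (r : nat) (x : 'I_r -> A).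

Definition alternant (e : 'I_r -> nat) : A := \det (\matrix_(i < r, j < r) x i ^+ e j).

(** In the expansion over permutations, multiplying the term of [s] by [x (s k)] raises the exponent
    of column [k] by one. *)
Lemma sum_mul_alternant e : (\sum_i x i) * alternant e =
  \sum_(k < r) alternant (fun j => (e j + (j == k))%N).
Proof.
rewrite /alternant.
have E f : \det (\matrix_(i < r, j < r) x i ^+ f j) =
    \sum_(s : 'S_r) (-1) ^+ s * \prod_j x (s j) ^+ f j.
  rewrite -det_tr; apply: eq_bigr => s _; congr (_ * _).
  by apply: eq_bigr => j _; rewrite !mxE.
rewrite E (eq_bigr _ (fun k _ => E _)) exchange_big /= mulr_sumr.
apply: eq_bigr => s _; rewrite -mulr_sumr mulrCA; congr (_ * _).
rewrite (reindex_inj (@perm_inj _ s)) /= mulr_suml.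
apply: eq_bigr => k _; rewrite (eq_bigr _ (fun j _ => exprD _ _ _)) big_split /= mulrC.
congr (_ * _); rewrite (bigD1 k) //= eqxx expr1 big1 ?mulr1 // => j /negPf ->.
by rewrite expr0.
Qed.

Lemma alternant_eq0 e (j k : 'I_r) : j != k -> e j = e k -> alternant e = 0.
Proof.
move=> jk ejk; rewrite /alternant -det_tr.
by apply: (determinant_alternate jk) => i; rewrite !mxE ejk.
Qed.
End Alternants.

Section SchurExpansion.
Variable r : nat.

Let a (l : seq nat) := alternant (@z r) (fun j => nth 0%N l j + (r - j.+1))%N.

(** Each factor z_1 + ... + z_r raises one exponent, which adds a box to the partition; forbidden
    additions give vanishing alternants, and the others are collected by the last box added. *)
Lemma alternant_expansion d :
  (\sum_(i < r) z i) ^+ d * alternant (@z r) (fun j => r - j.+1)%N =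
  \sum_(l <- partitions r d) (nsyt r d (nth 0%N l))%:R * a l.
Proof.
elim: d => [|d IHd].
  rewrite expr0 mul1r (perm_big [:: nseq r 0%N]) /=.
    rewrite big_seq1 mul1r /a; congr (alternant _); apply/funext => j.
    by rewrite nth_nseq if_same.
  apply: uniq_perm => [||l]; rewrite ?partitions_uniq // mem_partitions inE.
  apply/and3P/eqP => [[/eqP szl _] | ->].
    rewrite -szl; elim: (l) => //= y s IHs; rewrite addn_eq0 => /andP[/eqP-> /IHs <-] //.
  by rewrite size_nseq sumn_nseq eqxx; split=> //; apply/sorted_geqP => i; rewrite !nth_nseq !if_same.
rewrite exprS -mulrA IHd mulr_sumr /=.
have step l : l \in partitions r d ->
    (\sum_(i < r) z i) * ((nsyt r d (nth 0%N l))%:R * a l) =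
    \sum_(k < r | [forall i : 'I_r, (i.+1 == k) ==> (nth 0 l k < nth 0 l i)%N])
      (nsyt r d (nth 0%N l))%:R * a (incr_nth l k).
  rewrite mem_partitions => /and3P[/eqP szl /sorted_geqP sl _].
  rewrite mulrCA sum_mul_alternant mulr_sumr [RHS]big_mkcond /=.
  apply: eq_bigr => k _; case: ifP => [_ | /negbT].
    congr (_ * alternant _ _); apply/funext => j.
    by rewrite nth_incr_nth -val_eqE eq_sym [LHS]addnC addnA.
  move=> /forallPn[i0]; rewrite negb_imply -leqNgt => /andP[/eqP ik le_ik].
  (* The shifts of adjacent columns differ by one, so a box added below a row of equal length makes
     two exponents equal. *)
  rewrite (@alternant_eq0 _ _ _ _ i0 k) ?mulr0 //; first by rewrite -val_eqE /=; lia.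
  have ltk := ltn_ord k; have := sl i0; rewrite -val_eqE /= ik eqxx => sli.
  have -> : nth 0%N l i0 = nth 0%N l k by lia.
  by have -> : (i0 == k :> nat) = false; lia.
rewrite big_seq (eq_bigr _ step) -big_seq (exchange_big_dep predT) //=.
under [RHS]eq_bigr do rewrite natr_sum mulr_suml.
rewrite [RHS](exchange_big_dep predT) //=.
apply: eq_bigr => k _.
rewrite -[RHS]big_filter -(perm_big _ (partitions_incr d k)) /= big_map big_filter.
by apply: eq_bigr => l _; rewrite decr_incr_nth.
Qed.

(** After reversing the order of the exponents this is a product of differences of distinct
    indeterminates, told apart by one coefficient. *)
Lemma vandermonde_neq0 : alternant (@z r) (fun j => r - j.+1)%N != 0.
Proof.
pose v : 'rV[ratfun r]_r := \row_i z i.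
have -> : alternant (@z r) (fun j => r - j.+1)%N =
    \det (row_perm (perm rev_ord_inj) (Vandermonde r v)).
  rewrite /alternant -det_tr; congr (\det _); apply/matrixP => i j.
  by rewrite !mxE permE.
rewrite row_permE det_mulmx det_perm det_Vandermonde mulf_eq0 signr_eq0 /=.
rewrite prodf_seq_neq0; apply/allP => i _ /=; rewrite prodf_seq_neq0.
apply/allP => j _ /=; apply/implyP => ij; rewrite !mxE subr_eq0 tofrac_eq.
apply/eqP => /(congr1 (mcoeff U_(j)%MM)); rewrite !mcoeffX eqxx.
case: eqP => [/mnmP /(_ i) | _ /eqP]; last by rewrite oner_eq0.
by rewrite !mnm1E eqxx (_ : (j == i) = false) //; apply/negP => /eqP ji; rewrite ji ltnn in ij.
Qed.

Lemma schur_expansion d : (\sum_(i < r) z i) ^+ d =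
  \sum_(l <- partitions r d) (nsyt r d (nth 0%N l))%:R * schur r l.
Proof.
apply: (mulIf vandermonde_neq0); rewrite alternant_expansion mulr_suml.
apply: eq_bigr => l _; rewrite -mulrA; congr (_ * _).
by rewrite /schur -/(alternant _ _) divfK // vandermonde_neq0.
Qed.

End SchurExpansion.

(** * The exponential of a linear series *)

Section SeriesExp.
Variable A : fieldType.

Lemma series_pow_linear (a : A) k d :
  series_pow (series_linear a) k d = (d == k)%:R * a ^+ k.
Proof.
elim: k d => [|k IHk] d; first by rewrite expr0 mulr1.
rewrite /series_pow iterS -/(series_pow _ k) /series_mul.
case: d => [|d].
  by rewrite big_ord_recl big_ord0 /series_linear /= mul0r addr0 mul0r.
rewrite big_ord_recl big_ord_recl big1 /series_linear /= => [|i _]; last by rewrite mul0r.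
rewrite mul0r add0r addr0 subn1 /= -/(series_linear a) IHk eqSS exprS mulrCA //.
Qed.

Lemma series_exp_linear (a : A) d : series_exp (series_linear a) d = a ^+ d / d`!%:R.
Proof.
rewrite /series_exp big_ord_recr /= series_pow_linear eqxx mul1r big1 ?add0r // => i _.
rewrite series_pow_linear (_ : (d == i) = false) ?mul0r //.
by have := ltn_ord i; case: eqP => // <-; rewrite ltnn.
Qed.
End SeriesExp.

(** * Minors and their standard monomials *)

Section Columns.
Variables r n : nat.
Local Notation C := 'I_#|columns r n|.

Definition cols (k : C) (i : 'I_r) : 'I_n := tnth (enum_val k) i.

Lemma cols_mono k (i j : 'I_r) : (i < j)%N -> (cols k i < cols k j)%N.
Proof.
have := enum_valP k; rewrite inE => sk ij.
have := sorted_ltn_nth ltn_trans 0%N sk; rewrite /in_mem /= size_map size_tuple.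
move=> /(_ i j (ltn_ord i) (ltn_ord j) ij).
have nthE (l : 'I_r) : nth 0%N (map val (enum_val k)) l = cols k l.
  by rewrite (nth_map (cols k i)) ?size_tuple // [cols k l](tnth_nth (cols k i)).
by rewrite !nthE.
Qed.

Lemma cols_homo k (i j : 'I_r) : (i <= j)%N -> (cols k i <= cols k j)%N.
Proof.
by rewrite leq_eqVlt => /orP[/eqP/val_inj -> | ij]; [exact: leqnn | exact/ltnW/cols_mono].
Qed.

Lemma incr_ge (f : 'I_r -> nat) : (forall i j : 'I_r, (i < j)%N -> (f i < f j)%N) ->
  forall i : 'I_r, (i <= f i)%N.
Proof.
move=> f_incr [k lt_kr]; elim: k lt_kr => //= k IHk lt_kr.
by apply: leq_ltn_trans (IHk (ltnW lt_kr)) _; apply: f_incr.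
Qed.

Lemma cols_ge k (i : 'I_r) : (i <= cols k i)%N.
Proof. exact: (incr_ge (cols_mono k)). Qed.

Lemma eq_cols k k' : cols k =1 cols k' -> k = k'.
Proof. by move=> kk'; apply/enum_val_inj/eq_from_tnth. Qed.

Lemma ex_cols (f : 'I_r -> 'I_n) :
  (forall i j : 'I_r, (i < j)%N -> (f i < f j)%N) -> exists k, cols k =1 f.
Proof.
move=> f_incr; pose t := [tuple f i | i < r].
have tC : t \in columns r n.
  rewrite inE; apply/(sortedP 0%N) => i; rewrite size_map size_tuple => ltir.
  have lt' := ltnW ltir.
  rewrite !(nth_map (f (Ordinal ltir))) ?size_tuple //.
  rewrite -(tnth_nth _ t (Ordinal ltir)) -(tnth_nth _ t (Ordinal lt')) !tnth_mktuple.
  exact: f_incr.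
by exists (enum_rank_in tC t) => i; rewrite /cols enum_rankK_in // tnth_mktuple.
Qed.

Definition cle (k k' : C) : bool := [forall i, cols k i <= cols k' i]%N.

Lemma cleP k k' : reflect (forall i, cols k i <= cols k' i)%N (cle k k').
Proof. exact: forallP. Qed.

Lemma cle_refl : reflexive cle.
Proof. by move=> k; apply/cleP. Qed.

Definition below k : pred C := fun k' => cle k' k.

(** The standard monomials of degree [m], largest index first; [A] constrains only the leading
    index, each later one being below its predecessor. *)
Fixpoint stds (A : pred C) (m : nat) : seq (seq C) :=
  if m is m'.+1 then [seq k :: T | k <- enum A, T <- stds (below k) m']
  else [:: [::]].

Lemma stds_uniq A m : uniq (stds A m).
Proof.
elim: m A => //= m IHm A; apply: allpairs_uniq_dep => [|k _|]; rewrite ?enum_uniq //.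
by move=> [k T] [k' T'] _ _ /= [-> ->].
Qed.

Lemma mem_stds A m T : (T \in stds A m) =
  (size T == m) && (if T is k :: T' then A k && path (fun a b => cle b a) k T' else true).
Proof.
elim: m A T => [|m IHm] A [|k T] //=; first by apply/negP => /allpairsPdep[k [T []]].
apply/allpairsPdep/idP => [[k' [T' []]] | ].
  rewrite mem_enum => Ak' + [-> ->]; rewrite IHm eqSS => /andP[-> ].
  by rewrite -topredE /= in Ak'; rewrite Ak'; case: (T').
rewrite eqSS => /and3P[sz Ak path_T]; exists k, T; split=> //; first by rewrite mem_enum.
by rewrite IHm sz; case: (T) path_T.
Qed.

Lemma size_stds A m : size (stds A m.+1) = (\sum_(k | A k) size (stds (below k) m))%N.
Proof. by rewrite /= size_allpairs_dep sumnE big_map big_enum. Qed.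

End Columns.

Section Minors.
Variables (K : comNzRingType) (r n : nat).
Implicit Types (L : 'M[K]_(r, n)) (f : 'I_r -> 'I_n).

Definition minor L f : K := \det (colsub f L).

Lemma minorE L f : minor L f = \sum_(s : 'S_r) (-1) ^+ s * \prod_i L (s i) (f i).
Proof.
rewrite /minor -det_tr; apply: eq_bigr => s _; congr (_ * _).
by apply: eq_bigr => i _; rewrite !mxE.
Qed.

Lemma minor_perm L f (s : 'S_r) : minor L (f \o s) = (-1) ^+ s * minor L f.
Proof.
rewrite /minor (_ : colsub (f \o s) L = col_perm s (colsub f L)); last first.
  by apply/matrixP => i j; rewrite !mxE.
by rewrite col_permE det_mulmx det_perm odd_permV mulrC.
Qed.

End Minors.

Lemma minor_cols (K : fieldType) r n (L : 'M[K]_(r, n)) k :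
  minor L (cols k) = plucker L k.
Proof. by []. Qed.

(** A repeated column kills the minor; otherwise sorting the columns gives a Pluecker coordinate up
    to the sign of [s]. *)
Lemma sort_columns r n (f : 'I_r -> 'I_n) :
  (forall (K : comNzRingType) (L : 'M[K]_(r, n)), minor L f = 0) \/
  exists (k : 'I_#|columns r n|) (s : 'S_r), f =1 cols k \o s.
Proof.
case: (boolP (injectiveb f)) => [/injectiveP f_inj | /injectivePn[i [j ij fij]]]; last first.
  left=> K L; rewrite /minor -det_tr; apply: (determinant_alternate ij) => l.
  by rewrite !mxE fij.
right; pose t := [tuple f i | i < r].
pose le (a b : 'I_n) := (a <= b)%N.
have /tuple_permP[s ts] : perm_eq t (sort_tuple le t) by rewrite perm_sym perm_sort.
have fE i : f i = tnth (sort_tuple le t) (s i).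
  have tE : t = [tuple tnth (sort_tuple le t) (s i) | i < r] by apply: val_inj.
  by rewrite -[LHS](tnth_mktuple f) -/t tE tnth_mktuple -tE.
have le_tot : total le by move=> a b; apply: leq_total.
have srt := sort_sorted le_tot t.
have [k kE] : exists k, cols k =1 tnth (sort_tuple le t).
  apply: ex_cols => i j ij; rewrite ltn_neqAle; apply/andP; split.
    apply: contraTneq ij => tij; suff -> : i = j by rewrite ltnn.
    rewrite -(permKV s i) -(permKV s j); congr (s _).
    by apply: f_inj; rewrite !fE !permKV; apply: val_inj.
  have x0 := f i; rewrite !(tnth_nth x0) /=.
  have le_trans : transitive le by move=> a b c; apply: leq_trans.
  apply: (sorted_leq_nth le_trans _ x0 srt); rewrite ?inE ?size_sort ?size_tuple //.
  exact: (ltnW ij).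
by exists k, s => i; rewrite fE /= kE.
Qed.

(** * The exchange relation between two minors *)

Section Exchange.
Variables (r n : nat) (f g : 'I_r -> 'I_n) (j : 'I_r).

(** The r + 1 positions split into the low ones, at most [j], reached by [lift ord_max], and the
    high ones, reached by [lift ord0], which shifts by one. *)
Lemma big_split_at R (idx : R) (op : Monoid.com_law idx) (G : 'I_r.+1 -> R) :
  \big[op/idx]_k G k = op (\big[op/idx]_(i < r | i <= j) G (lift ord_max i))%N
                          (\big[op/idx]_(i < r | j <= i) G (lift ord0 i))%N.
Proof.
rewrite (bigID (fun k : 'I_r.+1 => k <= j)%N) /=; congr (op _ _).
  rewrite big_mkcond big_ord_recr /= leqNgt ltn_ord Monoid.mulm1 -big_mkcond /=.
  by apply: eq_big => [i|i _] //; congr G; apply: val_inj; rewrite /= /bump leqNgt ltn_ord.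
rewrite big_mkcond big_ord_recl /= Monoid.mul1m -big_mkcond /=.
by apply: eq_bigl => i; rewrite -ltnNge.
Qed.

(* The columns g_0, ..., g_j, f_j, ..., f_{r-1}: there are r + 1 of them, so
   that antisymmetrizing in them gives 0. *)
Definition xcols (k : 'I_r.+1) : 'I_n :=
  if (k <= j)%N then g (insubd j (k : nat)) else f (insubd j k.-1).

(** The permuted columns are dealt out again: the high positions complete the start of [f], the low
    ones replace the start of [g]. The identity gives back [f] and [g]. *)
Definition xleft (s : 'S_r.+1) (i : 'I_r) : 'I_n :=
  if (i < j)%N then f i else xcols (s (lift ord0 i)).

Definition xright (s : 'S_r.+1) (i : 'I_r) : 'I_n :=
  if (i <= j)%N then xcols (s (lift ord_max i)) else g i.

Lemma xcols_lo (i : 'I_r) : (i <= j)%N -> xcols (lift ord_max i) = g i.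
Proof. by rewrite /xcols lift_max => ->; congr g; apply: val_inj; rewrite val_insubd ltn_ord. Qed.

Lemma xcols_hi (i : 'I_r) : (j <= i)%N -> xcols (lift ord0 i) = f i.
Proof.
move=> ji; rewrite /xcols lift0 ltnNge ji /=.
by congr f; apply: val_inj; rewrite val_insubd ltn_ord.
Qed.

(** Once both minors are expanded over [p] and [q], the alternating sum over [s] is a determinant of
    size r + 1 whose rows are indexed by only r rows of [L]; two of them coincide. *)
Lemma exchange_sum (K : comNzRingType) (L : 'M[K]_(r, n)) :
  \sum_(s : 'S_r.+1) (-1) ^+ s * (minor L (xleft s) * minor L (xright s)) = 0.
Proof.
pose rest (p q : 'S_r) :=
  (\prod_(i < r | (i < j)%N) L (p i) (f i)) * \prod_(i < r | ~~ (i <= j)%N) L (q i) (g i).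
pose row (p q : 'S_r) (k : 'I_r.+1) :=
  if (k <= j)%N then q (insubd j (k : nat)) else p (insubd j k.-1).
have prodE (p q : 'S_r) (s : 'S_r.+1) :
    (\prod_i L (p i) (xleft s i)) * (\prod_i L (q i) (xright s i)) =
    rest p q * \prod_k L (row p q k) (xcols (s k)).
  rewrite [X in _ = _ * X]big_split_at /=.
  rewrite (bigID (fun i : 'I_r => i < j)%N) /= [X in _ * X = _](bigID (fun i : 'I_r => i <= j)%N) /=.
  set a := \prod_(i < r | _) _; set b := \prod_(i < r | _) _; set c := \prod_(i < r | _) _.
  set d := \prod_(i < r | _) _; rewrite [c * d]mulrC mulrACA [b * c]mulrC.
  rewrite /rest; congr (_ * _ * _).
  - by apply: eq_bigr => i ij; rewrite /xleft ij.
  - by apply: eq_bigr => i /negPf ij; rewrite /xright ij.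
  congr (_ * _).
    apply: eq_bigr => i ij; rewrite /xright ij /row lift_max ij.
    by congr (L (q _) _); apply: val_inj; rewrite val_insubd ltn_ord.
  apply: eq_big => i; rewrite -leqNgt // => ji.
  rewrite /xleft ltnNge ji /row lift0 ltnNge ji /=.
  by congr (L (p _) _); apply: val_inj; rewrite val_insubd ltn_ord.
transitivity (\sum_(p : 'S_r) \sum_(q : 'S_r) (-1) ^+ p * (-1) ^+ q * rest p q *
    \det (\matrix_(k, l) L (row p q k) (xcols l))).
  rewrite (eq_bigr (fun s : 'S_r.+1 => \sum_(p : 'S_r) \sum_(q : 'S_r)
      ((-1) ^+ p * (-1) ^+ q * rest p q) * ((-1) ^+ s * \prod_k L (row p q k) (xcols (s k))))).
    rewrite exchange_big; apply: eq_bigr => p _; rewrite exchange_big; apply: eq_bigr => q _.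
    rewrite -mulr_sumr; congr (_ * _); apply: eq_bigr => s _; congr (_ * _).
    by apply: eq_bigr => k _; rewrite mxE.
  move=> s _; rewrite !minorE mulr_suml mulr_sumr; apply: eq_bigr => p _.
  rewrite mulr_sumr mulr_sumr; apply: eq_bigr => q _.
  by rewrite mulrACA prodE mulrCA [X in _ * X = _]mulrCA -!mulrA.
rewrite big1 // => p _; rewrite big1 // => q _.
case: (boolP (injectiveb (row p q))) => [/injectiveP /leq_card | /injectivePn[k [l kl row_kl]]].
  by rewrite !card_ord ltnn.
by rewrite (determinant_alternate kl) ?mulr0 // => l'; rewrite !mxE row_kl.
Qed.

Definition keeps_low (s : 'S_r.+1) : bool := [forall k : 'I_r.+1, (k <= j) ==> (s k <= j)]%N.

Lemma keeps_low_high (s : 'S_r.+1) (k : 'I_r.+1) : keeps_low s -> (j < k)%N -> (j < s k)%N.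
Proof.
move=> /forallP low_s jk; pose A := [set k : 'I_r.+1 | k <= j]%N.
have sA : s @: A = A.
  apply/eqP; rewrite eqEcard card_imset ?leqnn ?andbT; last exact: perm_inj.
  apply/fintype.subsetP => _ /imsetP[l lA ->]; rewrite inE in lA; rewrite inE.
  by have /implyP := low_s l; apply.
rewrite ltnNge; apply/negP => skj.
have : s k \in s @: A by rewrite sA inE.
by rewrite mem_imset ?inE; [lia | exact: perm_inj].
Qed.

(** Such an [s] is a permutation of the low positions times one of the high positions. Each only
    reorders the columns of one minor, and the resulting signs cancel that of [s]. *)
Lemma exchange_keep (K : comNzRingType) (L : 'M[K]_(r, n)) (s : 'S_r.+1) : keeps_low s ->
  (-1) ^+ s * (minor L (xleft s) * minor L (xright s)) = minor L f * minor L g.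
Proof.
move=> low_s; have hi_s := fun k => keeps_low_high (k := k) low_s.
have {}low_s (k : 'I_r.+1) : (k <= j)%N -> (s k <= j)%N.
  by move: low_s => /forallP /(_ k) /implyP.
have jr := ltn_ord j.
(* High position i + 1 carries column i of [f], hence the predecessor; the default of [insubd] is
   never reached in [p] or [q]. *)
pose p (i : 'I_r) := if (i < j)%N then i else insubd j (s (lift ord0 i)).-1.
pose q (i : 'I_r) := if (i <= j)%N then insubd j (s (lift ord_max i) : nat) else i.
have hi_s0 (i : 'I_r) : (j <= i)%N -> (j < s (lift ord0 i) < r.+1)%N.
  by move=> ji; rewrite ltn_ord andbT; apply: hi_s; rewrite lift0.
have pE (i : 'I_r) : p i = (if (i < j)%N then i : nat else (s (lift ord0 i)).-1) :> nat.
  rewrite /p; case: ltnP => // /hi_s0 H; rewrite val_insubd.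
  by case: ifP => //; lia.
have low_s0 (i : 'I_r) : (i <= j)%N -> (s (lift ord_max i) <= j)%N.
  by move=> ij; apply: low_s; rewrite lift_max.
have qE (i : 'I_r) : q i = (if (i <= j)%N then s (lift ord_max i) : nat else i) :> nat.
  rewrite /q; case: leqP => // /low_s0 H; rewrite val_insubd.
  by case: ifP => //; lia.
have p_inj : injective p.
  move=> i i' /(congr1 val) /=; rewrite !pE.
  case: (ltnP i j) (@hi_s0 i) => ij H; case: (ltnP i' j) (@hi_s0 i') => ij' H' E.
  - exact: val_inj.
  - by move: (H' isT); lia.
  - by move: (H isT); lia.
  apply/(@lift_inj _ ord0)/(@perm_inj _ s)/val_inj => /=.
  by move: (H isT) (H' isT); lia.
have q_inj : injective q.
  move=> i i' /(congr1 val) /=; rewrite !qE.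
  case: (leqP i j) (@low_s0 i) => ij H; case: (leqP i' j) (@low_s0 i') => ij' H' E.
  - by apply/(@lift_inj _ ord_max)/(@perm_inj _ s)/val_inj.
  - by move: (H isT); lia.
  - by move: (H' isT); lia.
  - exact: val_inj.
have sE : s = (lift_perm ord0 ord0 (perm p_inj) * lift_perm ord_max ord_max (perm q_inj))%g.
  apply/permP => k; rewrite permM.
  have -> : lift_perm ord0 ord0 (perm p_inj) k = (if (k <= j)%N then k else s k).
    case: (unliftP ord0 k) => [i ->|->]; last by rewrite lift_perm_id.
    rewrite lift_perm_lift permE; apply: val_inj; rewrite [LHS]lift0 pE lift0.
    case: ltnP => ij; first by rewrite [RHS]lift0.
    rewrite /=; move: (hi_s0 _ ij); lia.
  have qk (k' : 'I_r.+1) : lift_perm ord_max ord_max (perm q_inj) k' = if (k' <= j)%N then s k' else k'.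
    case: (unliftP ord_max k') => [i ->|->]; last by rewrite lift_perm_id /= leqNgt jr.
    rewrite lift_perm_lift permE; apply: val_inj; rewrite [LHS]lift_max qE lift_max.
    by case: leqP => // _; rewrite [RHS]lift_max.
  case: (leqP k j) => kj; first by rewrite qk kj.
  by rewrite qk leqNgt hi_s.
have -> : xleft s = f \o perm p_inj.
  apply/funext => i; rewrite /= permE /xleft /p; case: ltnP => // ji.
  by rewrite /xcols leqNgt; have /andP[-> _] := hi_s0 i ji.
have -> : xright s = g \o perm q_inj.
  apply/funext => i; rewrite /= permE /xright /q; case: leqP => // ij.
  by rewrite /xcols low_s0.
rewrite !minor_perm {1}sE odd_permM !odd_lift_perm !addbb /=.
by rewrite [X in _ * X = _]mulrACA -signr_addb signrMK.
Qed.

End Exchange.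

Section ExchangeWeight.
Variables (r n : nat) (f g : 'I_r -> 'I_n) (j : 'I_r).

Let x := xcols f g j.

(** The two families together always use the same columns with multiplicity. *)
Lemma sum_xleft_xright (s : 'S_r.+1) :
  (\sum_i xleft f g j s i + \sum_i xright f g j s i = \sum_i f i + \sum_i g i)%N.
Proof.
pose rest : nat := (\sum_(i < r | i < j) f i + \sum_(i < r | ~~ (i <= j)%N) g i)%N.
have sumE (t : 'S_r.+1) :
    (\sum_i xleft f g j t i + \sum_i xright f g j t i = rest + \sum_k x k)%N.
  rewrite [X in (_ + X)%N = (_ + _)%N](bigID (fun i : 'I_r => i <= j)%N) /=.
  rewrite (bigID (fun i : 'I_r => i < j)%N) /=.
  rewrite (reindex_inj (@perm_inj _ t)) (big_split_at j) /=.
  have -> : (\sum_(i < r | i < j) xleft f g j t i = \sum_(i < r | i < j) f i)%N.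
    by apply: eq_bigr => i ij; rewrite /xleft ij.
  have -> : (\sum_(i < r | ~~ (i <= j)) xright f g j t i = \sum_(i < r | ~~ (i <= j)) g i)%N.
    by apply: eq_bigr => i /negPf ij; rewrite /xright ij.
  have -> : (\sum_(i < r | ~~ (i < j)) xleft f g j t i = \sum_(i < r | j <= i) x (t (lift ord0 i)))%N.
    by apply: eq_big => i; rewrite -leqNgt // => ji; rewrite /xleft ltnNge ji.
  have -> : (\sum_(i < r | i <= j) xright f g j t i = \sum_(i < r | i <= j) x (t (lift ord_max i)))%N.
    by apply: eq_bigr => i ij; rewrite /xright ij.
  by rewrite /rest [X in (_ + X)%N = _]addnC addnACA [X in (_ + X)%N = _]addnC.
rewrite sumE -(sumE 1%g); congr (_ + _)%N; apply: eq_bigr => i _.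
  by rewrite /xleft perm1; case: ltnP => // ji; rewrite xcols_hi.
by rewrite /xright perm1; case: leqP => // ij; rewrite xcols_lo.
Qed.

Hypothesis f_homo : forall i i' : 'I_r, (i <= i')%N -> (f i <= f i')%N.
Hypothesis g_homo : forall i i' : 'I_r, (i <= i')%N -> (g i <= g i')%N.
Hypothesis gf_j : (g j < f j)%N.

(** Low positions carry values at most [g j] and high positions values above it. A permutation
    mixing the blocks therefore moves some excess out of the left family. *)
Lemma sum_xleft_lt (s : 'S_r.+1) : ~~ keeps_low j s ->
  (\sum_i xleft f g j s i < \sum_i f i)%N.
Proof.
move=> /forallPn[k1]; rewrite negb_imply -ltnNge => /andP[k1j jsk1].
have x_lo (k : 'I_r.+1) : (k <= j)%N -> (x k <= g j)%N.
  move=> kj; rewrite /x /xcols kj; apply: g_homo; rewrite val_insubd.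
  by case: ifP.
have x_hi (k : 'I_r.+1) : (j < k)%N -> (g j < x k)%N.
  move=> jk; rewrite /x /xcols (leqNgt k) jk /=; apply: leq_trans gf_j _.
  by apply: f_homo; rewrite val_insubd; case: ifP => //; lia.
(* excess over the largest of the low values *)
pose y k := (x k - g j)%N.
rewrite (bigID (fun i : 'I_r => i < j)%N) [X in (_ < X)%N](bigID (fun i : 'I_r => i < j)%N) /=.
have -> : (\sum_(i < r | i < j) xleft f g j s i = \sum_(i < r | i < j) f i)%N.
  by apply: eq_bigr => i ij; rewrite /xleft ij.
rewrite ltn_add2l.
have -> : (\sum_(i < r | ~~ (i < j)) xleft f g j s i = \sum_(i < r | j <= i) x (s (lift ord0 i)))%N.
  by apply: eq_big => i; rewrite -leqNgt // => ji; rewrite /xleft ltnNge ji.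
have -> : (\sum_(i < r | ~~ (i < j)) f i = \sum_(i < r | j <= i) (g j + y (lift ord0 i)))%N.
  apply: eq_big => i; rewrite -leqNgt // => ji; rewrite subnKC; last first.
    by apply/ltnW/x_hi; rewrite lift0.
  by rewrite /x xcols_hi.
have le1 : (\sum_(i < r | j <= i) x (s (lift ord0 i)) <=
    \sum_(i < r | j <= i) (g j + y (s (lift ord0 i))))%N.
  by apply: leq_sum => i _; rewrite /y; lia.
apply: leq_ltn_trans le1 _; rewrite !big_split /= ltn_add2l.
have sum_y : (\sum_k y (s k) = \sum_k y k)%N by rewrite [RHS](reindex_inj (@perm_inj _ s)).
move: sum_y; rewrite !(big_split_at j) /= => sum_y.
have y_lo : (\sum_(i < r | i <= j) y (lift ord_max i) = 0)%N.
  by rewrite big1 // => i ij; apply/eqP; rewrite subn_eq0; apply: x_lo; rewrite lift_max.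
have : (0 < \sum_(i < r | i <= j) y (s (lift ord_max i)))%N.
  have k1r : (k1 < r)%N by have := ltn_ord j; lia.
  have k1E : k1 = lift ord_max (Ordinal k1r) by apply: val_inj; rewrite /= /bump leqNgt k1r.
  rewrite (bigD1 (Ordinal k1r)) //= -k1E addn_gt0 subn_gt0.
  by rewrite x_hi.
by rewrite y_lo add0n in sum_y; rewrite -sum_y -[X in _ -> (X < _)%N]add0n ltn_add2r.
Qed.
End ExchangeWeight.

(** * Straightening into standard monomials *)

Section Straightening.
Variables (K : numFieldType) (r n : nat).
Local Notation C := 'I_#|columns r n|.
Local Notation M := 'M[K]_(r, n).

Definition mono (L : M) (T : seq C) : K := \prod_(k <- T) plucker L k.

(** Functions of the matrix are used instead of formal polynomials in the Pluecker coordinates, so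
    that the Pluecker relations hold automatically. *)
Definition in_span m (phi : M -> K) := exists c : seq C -> K, forall L,
  phi L = \sum_(T <- stds predT m) c T * mono L T.

Lemma in_span0 m : in_span m (fun=> 0).
Proof. by exists (fun=> 0) => L; rewrite big1 // => T _; rewrite mul0r. Qed.

Lemma in_spanD m phi psi : in_span m phi -> in_span m psi ->
  in_span m (fun L => phi L + psi L).
Proof.
move=> [c phiE] [d psiE]; exists (fun T => c T + d T) => L.
by rewrite phiE psiE -big_split; apply: eq_bigr => T _; rewrite mulrDl.
Qed.

Lemma in_spanZ m a phi : in_span m phi -> in_span m (fun L => a * phi L).
Proof.
move=> [c phiE]; exists (fun T => a * c T) => L.
by rewrite phiE mulr_sumr; apply: eq_bigr => T _; rewrite mulrA.
Qed.

Lemma in_span_sum m (I : Type) (s : seq I) (P : pred I) (phi : I -> M -> K) :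
  (forall i, P i -> in_span m (phi i)) -> in_span m (fun L => \sum_(i <- s | P i) phi i L).
Proof.
move=> span_phi; elim: s => [|i s IHs].
  by under eq_fun do rewrite big_nil; apply: in_span0.
under eq_fun do rewrite big_cons.
by case: (boolP (P i)) => // Pi; apply: in_spanD => //; apply: span_phi.
Qed.

Lemma in_span_std m T : T \in stds predT m -> in_span m (mono^~ T).
Proof.
move=> T_std; exists (fun U => (U == T)%:R) => L.
rewrite (bigD1_seq T) ?stds_uniq //= eqxx mul1r big1 ?addr0 // => U /negPf ->.
by rewrite mul0r.
Qed.

Definition weight (k : C) : nat := (\sum_i cols k i)%N.

(** A sum of squares grows when two weights of fixed total move apart; it is bounded in each degree,
    so it can measure progress. *)
Definition energy (T : seq C) : nat := (\sum_(k <- T) weight k ^ 2)%N.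

Lemma energy_le T : (energy T <= size T * (r * n) ^ 2)%N.
Proof.
rewrite /energy -sum1_size big_distrl /=; apply: leq_sum => k _.
rewrite mul1n leq_sqr; apply: leq_trans (_ : \sum_(i < r) n <= _)%N.
  by apply: leq_sum => i _; apply/ltnW/ltn_ord.
by rewrite sum_nat_const card_ord.
Qed.

Lemma perm_mono L T U : perm_eq T U -> mono L T = mono L U.
Proof. by move=> TU; apply: perm_big. Qed.

Lemma sorted_cexP (T : Type) (e : rel T) s : ~~ sorted e s ->
  exists s1 a b s2, s = s1 ++ [:: a, b & s2] /\ ~~ e a b.
Proof.
elim: s => [//|a [//|b s] IHs] /=; rewrite negb_and.
have [eab /= /IHs[s1 [a' [b' [s2 [-> ?]]]]] | nab _] := boolP (e a b).
  by exists (a :: s1), a', b', s2.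
by exists [::], a, b, s.
Qed.

(** Sorting the columns of each minor either kills the product or gives, up to sign, Pluecker
    coordinates of the same weights. *)
Lemma in_span_minors m (f g : 'I_r -> 'I_n) (T : seq C) :
  (forall k l : C, weight k = (\sum_i f i)%N -> weight l = (\sum_i g i)%N ->
     in_span m (mono^~ [:: k, l & T])) ->
  in_span m (fun L => minor L f * minor L g * mono L T).
Proof.
move=> H; have weightE k (s : 'S_r) (h : 'I_r -> 'I_n) : h =1 cols k \o s ->
    weight k = (\sum_i h i)%N.
  by move=> hE; rewrite /weight (reindex_inj (@perm_inj _ s)); apply: eq_bigr => i _; rewrite hE.
have [f0 | [k [s fE]]] := sort_columns f.
  by under eq_fun do rewrite f0 !mul0r; apply: in_span0.
have [g0 | [l [t gE]]] := sort_columns g.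
  by under eq_fun do rewrite g0 mulr0 mul0r; apply: in_span0.
rewrite (_ : (fun L => _) = fun L => ((-1) ^+ s * (-1) ^+ t) * mono L [:: k, l & T]).
  by apply/in_spanZ/H; [apply: weightE fE | apply: weightE gE].
apply/funext => L; move: fE gE => /funext -> /funext ->.
by rewrite !minor_perm /mono !big_cons !minor_cols mulrACA -!mulrA.
Qed.

(* Antisymmetrizing in the columns around a violation b_j > a_j replaces b, a
   by pairs with the same total weight and a lighter first term: if b is the
   lighter of the two, then the energy grows. *)
Lemma straighten T : in_span (size T) (mono^~ T).
Proof.
have [N] := ubnP (size T * (r * n) ^ 2 - energy T)%N.
elim: N T => // N IHN T; rewrite ltnS => leTN.
(* Listing the factors by decreasing weight makes the second index of a violating adjacent pair the
   lighter one. *)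
pose le_w (a b : C) := (weight b <= weight a)%N.
have le_tot : total le_w by move=> a b; apply: leq_total.
have UT : perm_eq T (sort le_w T) by rewrite perm_sym perm_sort.
move: (sort_sorted le_tot T) UT; move: (sort _ _) => U U_srt TU.
rewrite (_ : mono^~ T = mono^~ U); last by apply/funext => L; apply: perm_mono.
have [U_std | /sorted_cexP[U1 [a [b [U2 [UE nba]]]]]] := boolP (sorted (fun a b => cle b a) U).
  by apply: in_span_std; rewrite mem_stds (perm_size TU) eqxx; case: (U) U_std.
have le_ba : (weight b <= weight a)%N.
  by move: U_srt; rewrite UE => /cat_sorted2[_ /= /andP[]].
have /forallPn[j] := nba; rewrite -ltnNge => lt_j.
pose f := cols b; pose g := cols a.
have f_homo : forall i i' : 'I_r, (i <= i')%N -> (f i <= f i')%N by move=> i i'; apply: cols_homo.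
have g_homo : forall i i' : 'I_r, (i <= i')%N -> (g i <= g i')%N by move=> i i'; apply: cols_homo.
pose R := U1 ++ U2.
have UR : perm_eq U [:: a, b & R].
  by rewrite UE perm_sym -[X in perm_eq X _]/([:: a; b] ++ U1 ++ U2) perm_catCA.
pose t (s : 'S_r.+1) (L : M) :=
  (-1) ^+ s * (minor L (xleft f g j s) * minor L (xright f g j s) * mono L R).
have span_t s : ~~ keeps_low j s -> in_span (size T) (t s).
  move=> low_s; apply/in_spanZ/in_span_minors => k l wk wl.
  have -> : size T = size [:: k, l & R] by rewrite (perm_size TU) (perm_size UR).
  apply: IHN; apply: leq_trans leTN.
  have -> : size [:: k, l & R] = size T by rewrite (perm_size TU) (perm_size UR).
  have := energy_le [:: k, l & R].
  have -> : size [:: k, l & R] = size T by rewrite (perm_size TU) (perm_size UR).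
  have := sum_xleft_xright f g j s; rewrite -wk -wl.
  have := sum_xleft_lt f_homo g_homo lt_j low_s; rewrite -wk.
  have -> : energy T = energy [:: a, b & R].
    by rewrite -[RHS](perm_big _ UR); apply: perm_big.
  rewrite /energy !big_cons -/(weight a) -/(weight b).
  move: (weight k) (weight l) (weight a) (weight b) le_ba => wk' wl' wa wb.
  move: (\sum_(_ <- R) _)%N (size T * _)%N => e B.
  move=> le_ba lt_k eq_kl le_B.
  (* The new weights are wb - d and wa + d with d > 0 and wb at most wa, so the sum of squares grows
     by 2d(wa - wb) + 2d^2. *)
  suff : (wa ^ 2 + wb ^ 2 < wk' ^ 2 + wl' ^ 2)%N by lia.
  have : (wb = wk' + (wb - wk'))%N by lia.
  move: (wb - wk')%N => d dE.
  have d0 : (0 < d)%N by lia.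
  have -> : wl' = (wa + d)%N by lia.
  by rewrite -!mulnn dE; nia.
(* Each of the [c] block-preserving permutations contributes the original product; in characteristic
   zero the exchange relation can be divided by [c]. *)
pose c := #|[pred s | keeps_low j s]|.
have c0 : c%:R != 0 :> K.
  rewrite pnatr_eq0 -lt0n; apply/card_gt0P; exists 1%g; rewrite inE.
  by apply/forallP => k; rewrite perm1 implybb.
rewrite (_ : mono^~ U = fun L => - c%:R^-1 * \sum_(s | ~~ keeps_low j s) t s L); last first.
  apply/funext => L; apply: (mulfI c0); rewrite mulrA mulrN divff // mulN1r.
  rewrite (perm_mono L UR) /mono !big_cons -/(mono L R) -!minor_cols -/f -/g.
  have E : (minor L f * minor L g) *+ c = - \sum_(s : 'S_r.+1 | ~~ keeps_low j s)
      (-1) ^+ s * (minor L (xleft f g j s) * minor L (xright f g j s)).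
    apply/eqP; rewrite -addr_eq0 -sumr_const; apply/eqP.
    rewrite -[RHS](exchange_sum f g j L) [RHS](bigID (keeps_low j)) /=; congr (_ + _).
    by apply: eq_big => s; rewrite ?inE // => /exchange_keep ->.
  rewrite [minor L g * _]mulrCA mulrA mulrA mulr_natl E mulNr mulr_suml; congr (- _).
  by apply: eq_bigr => s _; rewrite /t [RHS]mulrA.
by apply/in_spanZ/in_span_sum.
Qed.

End Straightening.

Lemma weight_lt r n (a b : 'I_#|columns r n|) : cle a b -> a != b -> (weight a < weight b)%N.
Proof.
move=> ab neq_ab; rewrite ltn_neqAle.
have [-> ->] : (weight a <= weight b ?= iff [forall (i | true), cols a i == cols b i :> nat])%N.
  by apply: leqif_sum => i _; apply/leqif_eq/cleP.
rewrite andbT; apply: contraNN neq_ab => /forall_inP ab_eq; apply/eqP/eq_cols => i.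
exact/val_inj/eqP/ab_eq.
Qed.

(** * Vanishing and independence on echelon matrices *)

Section Echelon.
Variables (K : fieldType) (r n : nat).
Local Notation C := 'I_#|columns r n|.
Local Notation M := 'M[K]_(r, n).

Definition echelon (w : C) (L : M) : Prop :=
  forall i (t : 'I_n), (cols w i < t)%N -> L i t = 0.

Lemma echelon_le v w L : cle v w -> echelon v L -> echelon w L.
Proof. by move=> /cleP vw vL i t wt; apply: vL; apply: leq_ltn_trans (vw i) wt. Qed.

(** If the minor were nonzero, selecting the columns of [k] would preserve the rank of [B]; but only
    the first [i] of these columns of [B] can be nonzero. *)
Lemma plucker_eq0_rank (k : C) (i : 'I_r) (L : M) m (B : 'M[K]_(m, n)) :
  (B <= L)%MS -> (i < \rank B)%N ->
  (forall a (t : 'I_n), (cols k i <= t)%N -> B a t = 0) -> plucker L k = 0.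
Proof.
move=> /submxP[D BE] rkB B0; apply/eqP; apply: contraTT rkB => det_neq0.
have unitN : colsub (cols k) L \in unitmx by rewrite unitmxE unitfE.
pose X := colsub (cols k) B.
have XE : X = D *m colsub (cols k) L.
  by apply/matrixP => a b; rewrite /X BE !mxE; apply: eq_bigr => c _; rewrite !mxE.
have Xpid : X = X *m pid_mx i.
  apply/matrixP => a b; rewrite [RHS]mxE (bigD1 b) //= big1 ?addr0.
    rewrite !mxE eqxx /=; case: ltnP => bi; first by rewrite mulr1.
    by rewrite mulr0 B0 // cols_homo.
  by move=> c /negPf cb; rewrite !mxE val_eqE cb mulr0.
rewrite -leqNgt BE; apply: leq_trans (mxrankM_maxl _ _) _.
rewrite -(@mxrankMfree _ _ _ _ D (colsub (cols k) L)) ?row_free_unit // -XE Xpid.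
by apply: leq_trans (mxrankM_maxr _ _) _; rewrite rank_pid_mx // ltnW.
Qed.

Lemma plucker_not_free (k : C) (L : M) : ~~ row_free L -> plucker L k = 0.
Proof.
move=> nfree; apply/eqP; apply: contraNT nfree => det_neq0.
have unitN : colsub (cols k) L \in unitmx by rewrite unitmxE unitfE.
rewrite /row_free eqn_leq rank_leq_row /=.
move: unitN; rewrite -row_free_unit /row_free => /eqP {1}<-.
have -> : colsub (cols k) L = L *m colsub (cols k) 1%:M.
  apply/matrixP => a b; rewrite !mxE (bigD1 (cols k b)) //= big1 ?addr0 => [|c /negPf cb].
    by rewrite !mxE eqxx mulr1.
  by rewrite !mxE cb mulr0.
exact: mxrankM_maxl.
Qed.

Lemma echelon_rows w (L : M) (i : 'I_r) : row_free L -> echelon w L ->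
  \rank ((pid_mx i.+1 : 'M_r) *m L) = i.+1 /\
  forall a (t : 'I_n), (cols w i < t)%N -> ((pid_mx i.+1 : 'M_r) *m L : M) a t = 0.
Proof.
move=> freeL echL; split; first by rewrite mxrankMfree // rank_pid_mx.
move=> a t wt; rewrite mxE big1 // => b _; rewrite !mxE.
case: eqP => [ab|]; last by rewrite mul0r.
case: ltnP => [ai|]; last by rewrite mul0r.
by rewrite echL ?mulr0 //; apply: leq_ltn_trans wt; apply: cols_homo; lia.
Qed.

Lemma plucker_echelon w k (L : M) : echelon w L -> ~~ cle k w -> plucker L k = 0.
Proof.
move=> echL /forallPn[i0]; rewrite -ltnNge => wk.
case: (boolP (row_free L)) => [freeL|]; last exact: plucker_not_free.
have [rkB B0] := echelon_rows i0 freeL echL.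
apply: (plucker_eq0_rank (submxMl (pid_mx i0.+1 : 'M_r) L) (i := i0)); first by rewrite rkB.
by move=> a t kt; apply: B0; apply: leq_trans kt.
Qed.

End Echelon.

Lemma poly_eq0_root (K : numFieldType) (p : {poly K}) : (forall x, p.[x] = 0) -> p = 0.
Proof.
move=> p0; apply: (@roots_geq_poly_eq0 _ p [seq i%:R | i <- iota 0 (size p)]).
- by apply/allP => x _; apply/eqP/p0.
- by rewrite map_inj_uniq ?iota_uniq // => i j /eqP; rewrite eqr_nat => /eqP.
- by rewrite size_map size_iota.
Qed.

Section Independence.
Variables (K : numFieldType) (r n : nat).
Local Notation C := 'I_#|columns r n|.
Local Notation M := 'M[K]_(r, n).

(* The lines through L in the direction of the coordinate matrix of w meet the
   open cell, where the last coordinate does not vanish. *)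
Lemma echelon_dense (w : C) (s : seq (seq C)) (c : seq C -> K) :
  let q := fun L : M => \sum_(T <- s) c T * mono L T in
  (forall L, echelon w L -> plucker L w * q L = 0) -> forall L, echelon w L -> q L = 0.
Proof.
move=> q pq0 L echL.
pose E : M := \matrix_(i, t) (t == cols w i)%:R.
pose Lx : 'M[{poly K}]_(r, n) := map_mx polyC L + 'X *: map_mx polyC E.
pose Q := \sum_(T <- s) (c T)%:P * \prod_(k <- T) minor Lx (cols k).
have LxE x : map_mx (horner_eval x) Lx = L + x *: E.
  by apply/matrixP => i t; rewrite !mxE /horner_eval !hornerE.
have minorE x k : (minor Lx (cols k)).[x] = plucker (L + x *: E) k.
  rewrite -minor_cols -LxE -[LHS]/(horner_eval x _) /minor -det_map_mx.
  by congr (\det _); apply/matrixP => i t; rewrite !mxE.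
have QE x : Q.[x] = q (L + x *: E).
  rewrite /Q horner_sum; apply: eq_bigr => T _.
  rewrite hornerM hornerC horner_prod; congr (_ * _).
  by apply: eq_bigr => k _; rewrite minorE.
have ech x : echelon w (L + x *: E).
  move=> i t wt; rewrite !mxE echL // add0r -val_eqE /= gtn_eqF // mulr0 //.
have PQ : minor Lx (cols w) * Q = 0.
  by apply: poly_eq0_root => x; rewrite hornerM minorE QE pq0.
(* This minor is triangular, with diagonal entries that are monic of degree one in the parameter of
   the line. *)
have P0 : minor Lx (cols w) != 0.
  rewrite /minor det_trig.
    rewrite prodf_seq_neq0; apply/allP => i _ /=.
    by rewrite !mxE eqxx polyC1 mulr1 addrC -size_poly_eq0 size_XaddC.
  apply/is_trig_mxP => i t it; have wit := cols_mono w it.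
  by rewrite !mxE echL // add0r -val_eqE /= gtn_eqF // polyC0 mulr0.
move/eqP: PQ; rewrite mulf_eq0 (negPf P0) /= => /eqP Q0.
by have := QE 0; rewrite Q0 horner0 scale0r addr0.
Qed.

(** Induction on the degree, then on the weight of the leading index [k]. On the matrices echelon
    for [k], indices not below [k] vanish and the smaller ones have zero coefficients already. What
    remains has the factor [plucker L k], which density cancels. *)
Lemma stds_indep m (w : C) (c : seq C -> K) :
  (forall L, echelon w L -> \sum_(T <- stds (below w) m) c T * mono L T = 0) ->
  forall T, T \in stds (below w) m -> c T = 0.
Proof.
elim: m w c => [|m IHm] w c c0 T.
  rewrite inE => /eqP ->; have ech0 : echelon w (0 : M) by move=> i t _; rewrite mxE.
  by have := c0 0 ech0; rewrite big_seq1 /mono big_nil mulr1.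
pose q k (L : M) := \sum_(U <- stds (below k) m) c (k :: U) * mono L U.
have qE L : \sum_(U <- stds (below w) m.+1) c U * mono L U = \sum_(k | cle k w) plucker L k * q k L.
  rewrite big_allpairs_dep big_enum_cond /=; apply: eq_big => [k|k _]; first by rewrite andbT.
  by rewrite mulr_sumr; apply: eq_bigr => U _; rewrite /mono big_cons mulrCA.
have {c0 qE}q0 L : echelon w L -> \sum_(k | cle k w) plucker L k * q k L = 0.
  by rewrite -qE; apply: c0.
suff main k : cle k w -> forall U, U \in stds (below k) m -> c (k :: U) = 0.
  move=> /allpairsPdep[k [U []]]; rewrite mem_enum => kw Uk ->; exact: main Uk.
have [N] := ubnP (weight k); elim: N k => // N IHN k; rewrite ltnS => leN kw.
apply: IHm; apply: echelon_dense => L echL.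
have := q0 L (echelon_le kw echL); rewrite (bigD1 k) //= [X in _ + X]big1 ?addr0 // => k' /andP[k'w k'k].
case: (boolP (cle k' k)) => [lek | /plucker_echelon]; last by move=> /(_ _ L echL) ->; rewrite mul0r.
rewrite /q big_seq big1 ?mulr0 // => U Uk'.
by rewrite (IHN k') ?mul0r //; apply: leq_trans (weight_lt lek k'k) leN.
Qed.

End Independence.

(** * Hilbert functions of Schubert varieties *)

Section AdaptedBasis.
Variables (K : fieldType) (n : nat).

(** Greedy choice: [G N] has rank above [N], so one of its rows lies outside the span of the [N]
    vectors already chosen. It is put on top, whence the reversed index. *)
Lemma row_free_choice (G : nat -> 'M[K]_n) N :
  (forall s t, (s <= t)%N -> (G s <= G t)%MS) ->
  (forall t, (t < N)%N -> (t < \rank (G t))%N) ->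
  exists2 e : 'M[K]_(N, n), row_free e & forall t : 'I_N, (row t e <= G (N - t.+1)%N)%MS.
Proof.
move=> G_mono; elim: N => [|N IHN] rkG.
  by exists 0; [rewrite -row_leq_rank | case].
have [e free_e eG] := IHN (fun t tN => rkG t (ltnW tN)).
have /row_subPn[i0 nsub] : ~~ (G N <= e)%MS.
  apply/negP => /mxrankS; rewrite leqNgt => /negP; apply.
  by move: free_e => /eqP ->; apply: rkG.
pose u := row i0 (G N).
exists (col_mx u e : 'M_(1 + N, n)).
  have rk_ue : \rank (col_mx u e) = \rank (u + e)%MS by rewrite addsmxE.
  have : (e < u + e)%MS by rewrite ltmxE addsmxSr addsmx_sub negb_and nsub.
  by rewrite ltmxErank -row_leq_rank rk_ue (eqP free_e) => /andP[].
move=> t; case: (@split_ordP 1 N t) => k ->.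
  rewrite (rowKu k u e) row_id; apply: submx_trans (row_sub i0 (G N)) _; apply: G_mono.
  by rewrite ord1 /= subSS subn0.
rewrite (rowKd k u e); apply: submx_trans (eG k) _; apply: G_mono.
by rewrite /=; lia.
Qed.

Lemma adapted_basis r (F : 'I_r -> 'M[K]_n) (w : 'I_r -> 'I_n) :
  (forall i, \rank (F i) = (w i).+1) -> (forall i j : 'I_r, (i <= j)%N -> (F i <= F j)%MS) ->
  exists2 g : 'M[K]_n, g \in unitmx &
    (forall i (t : 'I_n), (t <= w i)%N -> (row t g <= F i)%MS) /\
    (forall i a (t : 'I_n), (w i < t)%N -> (F i *m invmx g) a t = 0).
Proof.
move=> rkF F_mono.
(* This is the smallest [F i] whose dimension exceeds [t], or the whole space if there is none. *)
pose G t : 'M[K]_n := (\bigcap_(i < r | (t <= w i)%N) F i)%MS.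
have G_mono s t : (s <= t)%N -> (G s <= G t)%MS.
  move=> st; apply/sub_bigcapmxP => i ti; apply: (bigcapmx_inf i) => //.
  exact: leq_trans ti.
have rkG t : (t < n)%N -> (t < \rank (G t))%N.
  move=> tn; case: (pickP (fun i : 'I_r => t <= w i)%N) => [i1 ti1 | none]; last first.
    by rewrite /G big_pred0 // mxrank1.
  have [i0 ti0 i0_min] := @arg_minnP _ i1 (fun i => t <= w i)%N (fun i => i : nat) ti1.
  apply: leq_trans (_ : \rank (F i0) <= _)%N; first by rewrite rkF.
  by apply/mxrankS/sub_bigcapmxP => i2 ti2; apply/F_mono/i0_min.
have [e free_e eG] := row_free_choice G_mono rkG.
pose g := row_perm (perm (@rev_ord_inj n)) e.
have unit_g : g \in unitmx by rewrite /g row_permE unitmx_mul unitmx_perm -row_free_unit.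
have gF i (t : 'I_n) : (t <= w i)%N -> (row t g <= F i)%MS.
  move=> ti; have -> : row t g = row (rev_ord t) e by apply/rowP => j; rewrite !mxE permE.
  apply: submx_trans (eG _) _; apply: (bigcapmx_inf i) => //.
  by rewrite /= subnSK // subKn // ltnW.
exists g => //; split=> // i a t wit.
have PgF : ((pid_mx (w i).+1 : 'M_n) *m g <= F i)%MS.
  apply/row_subP => b; rewrite row_mul mulmx_sum_row; apply: summx_sub => c _.
  rewrite !mxE; case: eqP => [bc|] /=; last by rewrite scale0r sub0mx.
  by case: ltnP => bw; rewrite ?scale0r ?sub0mx // scale1r gF // -bc.
(* Equality of ranks turns the inclusion just proved into an equality of subspaces. *)
have FPg : (F i <= (pid_mx (w i).+1 : 'M_n) *m g)%MS.
  rewrite -(geq_leqif (mxrank_leqif_sup PgF)) rkF mxrankMfree ?row_free_unit //.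
  by rewrite rank_pid_mx.
have /submxP[D ->] := submxMr (invmx g) FPg.
rewrite mulmxK // mxE big1 // => c _; rewrite !mxE.
by case: eqP => [->|]; rewrite ?mulr0 // ltnS leqNgt wit mulr0.
Qed.

End AdaptedBasis.

(** * Forms evaluated after a change of basis *)

Section SpanProduct.
Variables (K : numFieldType) (r n : nat).
Local Notation C := 'I_#|columns r n|.
Local Notation M := 'M[K]_(r, n).

Lemma in_span_mono m (T : seq C) : size T = m -> in_span m (fun L : M => mono L T).
Proof. by move=> <-; apply: straighten. Qed.

Lemma in_spanM a b (phi psi : M -> K) : in_span a phi -> in_span b psi ->
  in_span (a + b) (fun L => phi L * psi L).
Proof.
move=> [c phiE] [d psiE].
rewrite (_ : (fun L => _) = fun L => \sum_(T <- stds predT a | T \in stds predT a)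
    \sum_(U <- stds predT b | U \in stds predT b) c T * d U * mono L (T ++ U)).
  apply: in_span_sum => T; rewrite mem_stds => /andP[/eqP sT _].
  apply: in_span_sum => U; rewrite mem_stds => /andP[/eqP sU _].
  by apply/in_spanZ/in_span_mono; rewrite size_cat sT sU.
apply/funext => L; rewrite phiE psiE -big_seq mulr_suml; apply: eq_bigr => T _.
rewrite -big_seq mulr_sumr; apply: eq_bigr => U _.
by rewrite /mono big_cat mulrACA.
Qed.

Lemma in_span1 : in_span 0 (fun _ : M => 1).
Proof.
rewrite (_ : (fun _ : M => 1) = fun L : M => mono L [::]); first exact: in_span_mono.
by apply/funext => L; rewrite /mono big_nil.
Qed.

Lemma in_spanX a e (phi : M -> K) : in_span a phi -> in_span (e * a) (fun L => phi L ^+ e).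
Proof.
move=> span_phi; elim: e => [|e IHe]; first exact: in_span1.
by under eq_fun do rewrite exprS; apply: in_spanM.
Qed.

Lemma in_span_prodX (I : Type) (s : seq I) (e : I -> nat) (phi : I -> M -> K) :
  (forall i, in_span 1 (phi i)) ->
  in_span (\sum_(i <- s) e i) (fun L => \prod_(i <- s) phi i L ^+ e i).
Proof.
move=> span_phi; elim: s => [|i s IHs].
  by rewrite big_nil; under eq_fun do rewrite big_nil; apply: in_span1.
rewrite big_cons (_ : (fun L => _) =
    fun L => phi i L ^+ e i * \prod_(k <- s) phi k L ^+ e k); last first.
  by apply/funext => L; rewrite big_cons.
by apply: in_spanM => //; have := in_spanX (e i) (span_phi i); rewrite muln1.
Qed.

(** This is the Cauchy-Binet expansion, taken over all maps [h] to the columns rather than over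
    increasing ones. *)
Lemma in_span_plucker_mul (g : 'M[K]_n) k :
  in_span 1 (fun L : M => plucker (L *m g) k).
Proof.
rewrite (_ : (fun L => _) = fun L : M => \sum_(h : {ffun 'I_r -> 'I_n})
    (\prod_i g (h i) (cols k i)) * minor L h).
  apply: in_span_sum => h _; apply: in_spanZ.
  have [h0 | [l [s hE]]] := sort_columns h.
    by under eq_fun do rewrite h0; apply: in_span0.
  rewrite (_ : (fun L => _) = fun L : M => (-1) ^+ s * mono L [:: l]).
    exact/in_spanZ/in_span_mono.
  apply/funext => L; rewrite /mono big_seq1 -minor_cols -minor_perm.
  by congr minor; apply/funext.
apply/funext => L; rewrite -minor_cols minorE.
under [RHS]eq_bigr do rewrite minorE mulr_sumr.
rewrite exchange_big; apply: eq_bigr => s _.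
under eq_bigr do rewrite mxE.
rewrite bigA_distr_bigA mulr_sumr; apply: eq_bigr => h _.
by rewrite big_split /= [X in _ * X = _]mulrC mulrCA.
Qed.

Lemma in_span1P (phi : M -> K) : in_span 1 phi ->
  exists a : C -> K, forall L, phi L = \sum_k a k * plucker L k.
Proof.
move=> [c phiE]; exists (fun k => c [:: k]) => L.
rewrite phiE big_allpairs_dep big_enum /=; apply: eq_bigr => k _.
by rewrite big_seq1 /mono big_seq1.
Qed.

Lemma in_span_meval m (g : 'M[K]_n) (p : {mpoly K[#|columns r n|]}) :
  p \is m.-homog -> in_span m (fun L : M => p.@[plucker (L *m g)]).
Proof.
move=> /dhomogP hp; under eq_fun do rewrite mevalE big_seq.
apply: in_span_sum => e /hp <-; apply: in_spanZ.
by rewrite /= mdegE; apply: in_span_prodX => i; apply: in_span_plucker_mul.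
Qed.

End SpanProduct.

(** Writing each basis in terms of the other gives two matrices, and uniqueness of coordinates makes
    their product the identity; ranks then compare [h] and [h']. *)
Lemma hilbert_function_leq (K : fieldType) N (X : set ('I_N -> K)) m h h' :
  hilbert_function X m h -> hilbert_function X m h' -> (h <= h')%N.
Proof.
move=> [b [hb bP]] [b' [hb' b'P]].
have /choice[A AP] : forall i, exists a : 'rV[K]_h',
    vanishes_on X (b i - \sum_(k < h') a 0 k *: b' k).
  by move=> i; have [c [cP _]] := b'P _ (hb i); exists c.
have /choice[B BP] : forall i, exists a : 'rV[K]_h,
    vanishes_on X (b' i - \sum_(k < h) a 0 k *: b k).
  by move=> i; have [c [cP _]] := bP _ (hb' i); exists c.
pose A' : 'M[K]_(h, h') := \matrix_(i, k) A i 0 k.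
pose B' : 'M[K]_(h', h) := \matrix_(i, k) B i 0 k.
suff AB1 : A' *m B' = 1%:M.
  rewrite -[X in (X <= _)%N](mxrank1 K h) -AB1.
  by apply: leq_trans (mxrankM_maxl _ _) (rank_leq_col _).
apply/row_matrixP => i.
have [c [_ cU]] := bP _ (hb i).
transitivity c; [symmetry|]; apply: cU => v Xv; last first.
  rewrite (bigD1 i) //= big1 ?addr0 => [|k ki].
    by rewrite !mxE eqxx scale1r subrr meval0.
  by rewrite !mxE eq_sym (negPf ki) scale0r.
have := AP i v Xv; rewrite mevalB => /eqP; rewrite subr_eq0 => /eqP bE.
rewrite mevalB bE; apply/eqP; rewrite subr_eq0 !raddf_sum /=; apply/eqP.
transitivity (\sum_(k < h') \sum_(l < h) A i 0 k * B k 0 l * (b l).@[v]).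
  apply: eq_bigr => k _; rewrite mevalZ.
  have := BP k v Xv; rewrite mevalB => /eqP; rewrite subr_eq0 => /eqP ->.
  by rewrite raddf_sum mulr_sumr /=; apply: eq_bigr => l _; rewrite mevalZ mulrA.
rewrite exchange_big; apply: eq_bigr => l _.
by rewrite mevalZ !mxE mulr_suml; apply: eq_bigr => k _; rewrite !mxE.
Qed.

Section SchubertHilbert.
Variables (K : numFieldType) (r n : nat).
Local Notation C := 'I_#|columns r n|.
Local Notation M := 'M[K]_(r, n).

Lemma sum_stds_below (V : nmodType) (w : C) m (F : seq C -> V) :
  (forall k T, ~~ below w k -> F (k :: T) = 0) ->
  \sum_(T <- stds predT m.+1) F T = \sum_(T <- stds (below w) m.+1) F T.
Proof.
move=> F0; rewrite !big_allpairs_dep !big_enum_cond /= big_mkcond [RHS]big_mkcond /=.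
apply: eq_bigr => k _; rewrite andbT -topredE /=; case: ifPn => // wk.
by rewrite big1 // => T _; apply: F0.
Qed.

(** [X] is squeezed between the image of the full-rank echelon matrices, where standard monomials
    below [w] are independent, and a set where all others vanish. Straightening provides
    spanning. *)
Lemma hilbert_standard (w : C) (g : 'M[K]_n) (X : set (C -> K)) m : g \in unitmx ->
  (forall v, X v -> exists2 L : M, v = plucker (L *m g) &
     forall k, ~~ below w k -> plucker L k = 0) ->
  (forall L : M, echelon w L -> row_free L -> X (plucker (L *m g))) ->
  hilbert_function X m.+1 (size (stds (below w) m.+1)).
Proof.
move=> unit_g X_sub sub_X; set S := stds _ _.
have /choice[a aP] : forall k, exists a : C -> K, forall L : M,
    plucker L k = \sum_l a l * plucker (L *m g) l.
  move=> k; have [a aE] := in_span1P (in_span_plucker_mul (r := r) (invmx g) k).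
  by exists a => L; rewrite -aE mulmxK.
(* Linear forms which, evaluated at the point of [L *m g], recover the Pluecker coordinates of
   [L]. *)
pose y k : {mpoly K[#|columns r n|]} := \sum_l a k l *: 'X_l.
pose b T := \prod_(k <- T) y k.
have yE k L : (y k).@[plucker (L *m g)] = plucker L k.
  by rewrite aP /y raddf_sum /=; apply: eq_bigr => l _; rewrite mevalZ mevalXU.
have bE T L : (b T).@[plucker (L *m g)] = mono L T.
  by rewrite /b rmorph_prod; apply: eq_bigr => k _; apply: yE.
have y_homog k : y k \is 1.-homog.
  by apply: rpred_sum => l _; apply: dhomogZ; rewrite dhomogX /= mdeg1.
have b_homog T : b T \is (size T).-homog.
  rewrite /b; elim: T => [|k T IHT]; first by rewrite big_nil dhomog1.
  by rewrite big_cons; apply: (dhomogM (y_homog k) IHT).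
have sumS (V : nmodType) (F : seq C -> V) :
    \sum_(i < size S) F (nth [::] S i) = \sum_(T <- S) F T.
  by rewrite (big_nth [::]) big_mkord.
have evS (c : 'rV[K]_(size S)) L :
    (\sum_(i < size S) c 0 i *: b (nth [::] S i)).@[plucker (L *m g)] =
    \sum_(i < size S) c 0 i * mono L (nth [::] S i).
  by rewrite raddf_sum /=; apply: eq_bigr => i _; rewrite mevalZ bE.
exists (fun i => b (nth [::] S i)); split=> [i | p hp].
  have := mem_nth [::] (ltn_ord i); rewrite mem_stds => /andP[/eqP sz _].
  by have := b_homog (nth [::] S i); rewrite sz.
have [c0 c0E] := in_span_meval g hp.
exists (\row_i c0 (nth [::] S i)); split=> [v /X_sub[L -> L0] | c cP].
  apply/eqP; rewrite mevalB subr_eq0 c0E evS (sum_stds_below (w := w)).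
    rewrite -/S -sumS; apply/eqP/eq_bigr => i _; by rewrite mxE.
  by move=> k T /L0 Lk0; rewrite /mono big_cons Lk0 mul0r mulr0.
(* The difference of two coordinate vectors, indexed by monomials instead of positions in [S]. *)
pose d T := c0 T - (if insub (index T S) is Some i then c 0 i else 0).
have d0 : forall T, T \in S -> d T = 0.
  apply: stds_indep => L echL; rewrite -/S.
  (* Matrices of smaller rank give no point of [X], but all their minors vanish and the degree is
     positive. *)
  have [freeL | nfreeL] := boolP (row_free L); last first.
    rewrite big_seq big1 // => T; rewrite mem_stds; case: T => // k T _.
    by rewrite /mono big_cons (plucker_not_free _ nfreeL) mul0r mulr0.
  have /eqP := cP _ (sub_X L echL freeL).
  rewrite mevalB subr_eq0 c0E evS (sum_stds_below (w := w)); last first.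
    by move=> k T wk; rewrite /mono big_cons (plucker_echelon echL) // mul0r mulr0.
  rewrite -/S -sumS => /eqP E; rewrite -sumS.
  under eq_bigr do rewrite mulrBl.
  rewrite sumrB E; apply/eqP; rewrite subr_eq0; apply/eqP/eq_bigr => i _.
  by rewrite index_uniq ?stds_uniq // valK.
apply/rowP => i; rewrite mxE; apply/eqP; rewrite -subr_eq0; apply/eqP.
by rewrite -[RHS](d0 _ (mem_nth [::] (ltn_ord i))) /d index_uniq ?stds_uniq // valK.
Qed.

(** In an adapted basis, a large intersection with [F i] forces the coordinates not below [w] to
    vanish; conversely the first i + 1 rows of an echelon matrix land in [F i]. *)
Lemma hilbert_schubert (w : C) (F : 'I_r -> 'M[K]_n) m :
  (forall i, \rank (F i) = (cols w i).+1) -> (forall i j : 'I_r, (i <= j)%N -> (F i <= F j)%MS) ->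
  hilbert_function (schubert F) m.+1 (size (stds (below w) m.+1)).
Proof.
move=> rkF F_mono.
have [g unit_g [gF Fg]] := adapted_basis rkF F_mono.
refine (hilbert_standard m unit_g _ _) => [v [M0 [_ rkM ->]] | L echL freeL].
  exists (M0 *m invmx g); first by rewrite mulmxKV.
  move=> k /forallPn[i0]; rewrite -ltnNge => wk.
  apply: (plucker_eq0_rank (i := i0) (B := (M0 :&: F i0)%MS *m invmx g)).
  - exact/submxMr/capmxSl.
  - by rewrite mxrankMfree // row_free_unit unitmx_inv.
  move=> a t kt; have /submxP[D ->] := capmxSr M0 (F i0).
  rewrite -mulmxA mxE big1 // => c _; rewrite Fg ?mulr0 //; exact: leq_trans kt.
exists (L *m g); split=> //.
  by rewrite /row_free mxrankMfree // row_free_unit.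
move=> i; have [rkB B0] := echelon_rows i freeL echL.
have <- : \rank ((pid_mx i.+1 : 'M_r) *m L *m g) = i.+1 by rewrite mxrankMfree // row_free_unit.
apply: mxrankS; rewrite sub_capmx -mulmxA submxMl /= mulmxA.
apply/row_subP => a; rewrite row_mul mulmx_sum_row; apply: summx_sub => t _.
have [wt | tw] := ltnP (cols w i) t; last exact/scalemx_sub/gF.
by rewrite mxE B0 // scale0r sub0mx.
Qed.

End SchubertHilbert.

(** * Degrees of Schubert varieties *)

Section Chains.
Variables r n : nat.
Local Notation C := 'I_#|columns r n|.
Implicit Types (w k : C) (i j : 'I_r).

Fixpoint chains (w : C) (d : nat) : nat :=
  if d is d'.+1 then \sum_(k | below w k && (k != w)) chains k d' else 1.

Arguments chains : simpl never.

Lemma chainsS w d : chains w d.+1 = (\sum_(k | below w k && (k != w)) chains k d)%N.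
Proof. by []. Qed.

(** A multichain starts either at [w] or strictly below it; the two counts combine by the Pascal
    rule. *)
Lemma size_stds_chains w m :
  (size (stds (below w) m) = \sum_(d < m.+1) chains w d * 'C(m, d))%N.
Proof.
elim: m w => [|m IHm] w; first by rewrite big_ord1.
rewrite size_stds (bigD1 w) /=; last exact: cle_refl.
have -> : (size (stds (below w) m) = chains w 0 + \sum_(d < m.+1) chains w d.+1 * 'C(m, d.+1))%N.
  by rewrite IHm big_ord_recl [in RHS]big_ord_recr /= bin0 muln1 (@bin_small m) // muln0 addn0.
rewrite [RHS]big_ord_recl bin0 muln1 -addnA; congr (_ + _)%N.
rewrite (eq_bigr _ (fun k _ => IHm k)) exchange_big -big_split; apply: eq_bigr => d _ /=.
by rewrite -big_distrl -chainsS -mulnDr binS.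
Qed.

Definition height w : nat := (\sum_i (cols w i - i))%N.

Lemma weight_height w : weight w = (height w + \sum_(i < r) i)%N.
Proof. by rewrite /height -big_split; apply: eq_bigr => i _; rewrite /= subnK // cols_ge. Qed.

Lemma height_lt k w : below w k -> k != w -> (height k < height w)%N.
Proof. by move=> kw /(weight_lt kw); rewrite !weight_height ltn_add2r. Qed.

Lemma chains_eq0 w d : (height w < d)%N -> chains w d = 0%N.
Proof.
elim: d w => // d IHd w; rewrite ltnS => wd; rewrite chainsS big1 // => k /andP[kw neq_kw].
by apply/IHd/(leq_trans (height_lt kw neq_kw)).
Qed.

Lemma sum_ord_vanish (f : nat -> nat) a b : (forall l, (a <= l)%N -> f l = 0%N) ->
  (forall l, (b <= l)%N -> f l = 0%N) -> (\sum_(l < a) f l = \sum_(l < b) f l)%N.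
Proof.
wlog ab : a b / (a <= b)%N.
  by move=> H fa fb; case: (leqP a b) => [|/ltnW] ab; [|symmetry]; apply: H.
move=> fa _; rewrite (big_ord_widen b f ab) big_mkcond /=.
by apply: eq_bigr => l _; case: ltnP => // /fa ->.
Qed.

(** The partition attached to [w]; the order is reversed because the differences between columns and
    positions increase weakly with the position. *)
Definition shape w (j : nat) : nat :=
  if insub j is Some i then (cols w (rev_ord i) - rev_ord i)%N else 0%N.

Lemma shape_rev w i : shape w (r - i.+1) = (cols w i - i)%N.
Proof.
have lt_ir : (r - i.+1 < r)%N by have := ltn_ord i; lia.
rewrite /shape (insubT (fun l => l < r)%N lt_ir).
by have -> : rev_ord (Sub (r - i.+1)%N lt_ir) = i by apply: val_inj; rewrite /= subnSK ?subKn // ltnW.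
Qed.

Lemma shape_out w (j : nat) : (r <= j)%N -> shape w j = 0%N.
Proof. by move=> rj; rewrite /shape insubF // ltnNge rj. Qed.

Lemma shape_drop k w i : (forall j, cols k j = cols w j - (j == i) :> nat)%N ->
  shape k = decr (shape w) (r - i.+1).
Proof.
move=> kE; apply/funext => j; rewrite /decr.
case: (ltnP j r) => [jr | rj]; last by rewrite !shape_out.
have -> : j = (r - (rev_ord (Ordinal jr)).+1)%N by rewrite /= subnSK // subKn // ltnW.
move: (rev_ord _) => j'; rewrite !shape_rev kE.
have -> : (r - j'.+1 == r - i.+1)%N = (j' == i).
  by rewrite -val_eqE /=; have := ltn_ord i; have := ltn_ord j'; lia.
lia.
Qed.

(** The corner condition of [nsyt] for the row belonging to position [i]. For i = 0 the next row has
    number r, where [shape] is 0. *)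
Definition droppable w i : bool := (shape w (r - i) < shape w (r - i.+1))%N.

Definition drop_col w i : C :=
  odflt w [pick k | [forall j, cols k j == (cols w j - (j == i))%N :> nat]].

Lemma droppableP w i : reflect
  ((i < cols w i)%N /\ (forall j, (j.+1 = i)%N -> ((cols w j).+1 < cols w i)%N)) (droppable w i).
Proof.
rewrite /droppable shape_rev.
case: (posnP i) => [i0 | i_gt0].
  rewrite shape_out ?i0 ?subn0 //.
  apply: (iffP idP) => [-> | []] //; split=> // j; lia.
have ltr : (i.-1 < r)%N by have := ltn_ord i; lia.
have -> : (r - i)%N = (r - (Ordinal ltr).+1)%N by rewrite /= prednK.
have := cols_ge w (Ordinal ltr); rewrite shape_rev /= => ge.
apply: (iffP idP) => [lt | [lt /(_ (Ordinal ltr))]]; last by rewrite /=; lia.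
split=> [|j ji]; first by lia.
have <- : Ordinal ltr = j by apply: val_inj => /=; lia.
lia.
Qed.

Lemma cols_drop w i : droppable w i ->
  forall j, cols (drop_col w i) j = (cols w j - (j == i))%N :> nat.
Proof.
move=> /droppableP[lt_i drop_i] j; rewrite /drop_col; case: pickP => [k /forallP kE | none].
  exact/eqP/kE.
have lt_n l : ((cols w l - (l == i)) < n)%N by apply: leq_ltn_trans (leq_subr _ _) (ltn_ord _).
have [|k kE] := @ex_cols r n (fun l => Ordinal (lt_n l)).
  move=> a b ab /=; have := cols_mono w ab.
  case: (eqVneq b i) => [bi | _]; last by lia.
  rewrite bi in ab *; have ltr : (i.-1 < r)%N by have := ltn_ord i; lia.
  have := drop_i (Ordinal ltr); rewrite /= prednK; last by lia.
  have : (cols w a <= cols w (Ordinal ltr))%N by apply: cols_homo => /=; lia.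
  by case: (a == i) => /=; lia.
by have := none k; move=> /negbT/forallPn[l]; rewrite kE eqxx.
Qed.

Lemma weight_drop w i : droppable w i -> weight w = (weight (drop_col w i)).+1.
Proof.
move=> drop_i; have kE := cols_drop drop_i; have /droppableP[lt_i _] := drop_i.
rewrite /weight (bigD1 i) // [in RHS](bigD1 i) //= kE eqxx.
rewrite (eq_bigr (fun j => cols (drop_col w i) j : nat)); last first.
  by move=> j /negPf ji; rewrite kE ji subn0.
lia.
Qed.

(** Maximal chains satisfy the recursion of tableaux: the elements covered by [w] correspond to the
    corners of its shape. *)
Lemma chains_height d w : height w = d -> chains w d = nsyt r d (shape w).
Proof.
elim: d w => // d IHd w wd; rewrite chainsS /=.
transitivity (\sum_(k in [set drop_col w i | i in [set i | droppable w i]]) chains k d)%N.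
  (* An index of height less than [d] is too low to start a chain with [d] further steps. *)
  rewrite (bigID (fun k => height k == d)) /= [X in (_ + X)%N]big1 ?addn0; last first.
    move=> k /andP[/andP[kw neq_kw] neq_d]; apply: chains_eq0.
    by have := height_lt kw neq_kw; lia.
  apply: eq_bigl => k; apply/andP/imsetP => [[/andP[kw neq_kw] /eqP kd] | [i drop_i]].
    (* The heights differ by one, so exactly one column has been lowered, and by one. *)
    have wt : (\sum_i (cols w i - cols k i) = 1)%N.
      rewrite sumnB; last by move=> i _; apply/cleP.
      by rewrite -/(weight w) -/(weight k) !weight_height; lia.
    have [i ki] : exists i, (cols k i < cols w i)%N.
      apply/fintype.existsP; apply: contraTT isT => /existsPn ge.
      move: wt; rewrite big1 // => i _; have := ge i; lia.
    have kE j : cols k j = (cols w j - (j == i))%N :> nat.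
      move: wt; rewrite (bigD1 i) //=; case: (eqVneq j i) => [-> | ji]; first lia.
      rewrite (bigD1 j) //=; have /cleP /(_ j) := kw; lia.
    have drop_i : droppable w i.
      apply/droppableP; split; first by have := cols_ge k i; rewrite kE eqxx; lia.
      move=> j ji; have ij : (j < i)%N by lia.
      have := cols_mono k ij; rewrite !kE eqxx.
      by have -> : (j == i) = false; [rewrite -val_eqE /=; lia | lia].
    exists i; first by rewrite inE.
    by apply: eq_cols => j; apply: val_inj; rewrite /= kE cols_drop.
  move: drop_i; rewrite inE => drop_i ->; have kE := cols_drop drop_i.
  have wE := weight_drop drop_i.
  split; last by move: wE; rewrite !weight_height; lia.
  apply/andP; split; first by apply/cleP => j; rewrite kE leq_subr.
  by apply: contra_eqN wE => /eqP ->; lia.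
rewrite big_imset /=; last first.
  move=> i j; rewrite !inE => drop_i drop_j /(congr1 (fun k => cols k i : nat)).
  rewrite !cols_drop // eqxx; have /droppableP[lt_i _] := drop_i.
  by case: eqP => // _; lia.
rewrite [RHS](reindex_inj rev_ord_inj) /=; apply: eq_big => [i | i].
  by rewrite inE /droppable subnSK.
rewrite inE => drop_i; rewrite -(shape_drop (cols_drop drop_i)); apply: IHd.
have wE := weight_drop drop_i.
by move: wE; rewrite !weight_height; lia.
Qed.

End Chains.

(** * Binomial coefficients as polynomials *)

Section BinomialPolynomials.

Definition binpoly k : {poly rat} :=
  k`!%:R^-1 *: \prod_(x <- [seq i%:R | i <- iota 0 k]) ('X - x%:P).

Lemma horner_binpoly k m : (binpoly k).[m%:R] = 'C(m, k)%:R.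
Proof.
have fact_neq0 : k`!%:R != 0 :> rat by rewrite pnatr_eq0 -lt0n fact_gt0.
rewrite /binpoly hornerZ; apply: (mulfI fact_neq0); rewrite mulrA divff // mul1r.
rewrite -natrM mulnC bin_ffact big_map horner_prod.
elim: k {fact_neq0} => [|k IHk]; first by rewrite big_nil.
rewrite -addn1 iotaD big_cat big_seq1 /= IHk addn1 ffactnSr add0n !hornerE.
case: (leqP k m) => km; first by rewrite natrM natrB.
by rewrite ffact_small // !mul0r.
Qed.

Lemma size_binpoly k : size (binpoly k) = k.+1.
Proof.
rewrite size_scale ?invr_eq0 ?pnatr_eq0 -?lt0n ?fact_gt0 //.
by rewrite size_prod_XsubC size_map size_iota.
Qed.

Lemma lead_coef_binpoly k : lead_coef (binpoly k) = k`!%:R^-1.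
Proof. by rewrite lead_coefZ (monicP (monic_prod_XsubC _ _ _)) mulr1. Qed.

(** Only the term of index [d] reaches degree [d], so it alone determines the leading
    coefficient. *)
Lemma poly_of_binomials (c : nat -> nat) d : (0 < c d)%N ->
  let P := \sum_(k < d.+1) (c k)%:R *: binpoly k in
  size P = d.+1 /\ d`!%:R * lead_coef P = (c d)%:R.
Proof.
move=> cd P; have fact_neq0 : d`!%:R != 0 :> rat by rewrite pnatr_eq0 -lt0n fact_gt0.
have Pd : P`_d = (c d)%:R / d`!%:R.
  rewrite coef_sum big_ord_recr /= big1 ?add0r => [|k _].
    by rewrite coefZ -lead_coef_binpoly /lead_coef size_binpoly.
  by rewrite coefZ nth_default ?mulr0 // size_binpoly.
have sP : size P = d.+1.
  apply/eqP; rewrite eqn_leq; apply/andP; split.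
    apply: leq_trans (size_sum _ _ _) _; apply/bigmax_leqP => k _.
    by apply: leq_trans (size_scale_leq _ _) _; rewrite size_binpoly.
  rewrite ltnNge; apply/negP => /leq_sizeP /(_ d (leqnn d)) /eqP.
  by rewrite Pd mulf_eq0 invr_eq0 (negPf fact_neq0) orbF pnatr_eq0 -leqn0 leqNgt cd.
by split=> //; rewrite /lead_coef sP Pd mulrCA divff // mulr1.
Qed.

Lemma poly_eq0_large (m0 : nat) (p : {poly rat}) :
  (forall m, (m0 <= m)%N -> p.[m%:R] = 0) -> p = 0.
Proof.
move=> p0; apply: (@roots_geq_poly_eq0 _ p [seq i%:R | i <- iota m0 (size p)]).
- by apply/allP => x /mapP[m]; rewrite mem_iota => /andP[/p0 pm _] ->; apply/eqP.
- by rewrite map_inj_uniq ?iota_uniq // => i j /eqP; rewrite eqr_nat => /eqP.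
- by rewrite size_map size_iota.
Qed.

End BinomialPolynomials.

Lemma sum_nth_sumn l N : (forall i, (N <= i)%N -> nth 0%N l i = 0%N) ->
  (\sum_(i < N) nth 0%N l i = sumn l)%N.
Proof.
move=> l0; rewrite sumnE (big_nth 0%N) big_mkord; apply: sum_ord_vanish => // i.
exact: nth_default.
Qed.

(** The dimensions of the flag determine an index [w] of shape [l]. The Hilbert polynomial is the
    chain count written in binomial polynomials, and its top coefficient counts maximal chains, that
    is, tableaux. *)
Lemma schubert_degree (K : numFieldType) r n l (F : 'I_r -> 'M[K]_n) D :
  sorted geq l -> (forall i, (r <= i)%N -> nth 0%N l i = 0%N) -> is_flag l F ->
  has_degree (schubert F) D <-> D = nsyt r (sumn l) (nth 0%N l).
Proof.
move=> sl l0 [rkF F_lt].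
have lt_n i : ((\rank (F i)).-1 < n)%N by have := rank_leq_col (F i); rewrite rkF; lia.
have F_mono (i j : 'I_r) : (i <= j)%N -> (F i <= F j)%MS.
  by rewrite leq_eqVlt => /orP[/eqP/val_inj -> //|/F_lt/ltmxW].
have [|w wE] := @ex_cols r n (fun i => Ordinal (lt_n i)).
  move=> i j /F_lt; rewrite ltmxErank => /andP[_] /=; rewrite !rkF; lia.
have rk_w i : \rank (F i) = (cols w i).+1 by rewrite wE /= rkF.
have shapeE : shape w = nth 0%N l.
  apply/funext => j; case: (ltnP j r) => [jr | rj]; last by rewrite shape_out ?l0.
  have -> : j = (r - (rev_ord (Ordinal jr)).+1)%N by rewrite /= subnSK // subKn // ltnW.
  by move: (rev_ord _) => i; rewrite shape_rev wE /= rkF; lia.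
have heightE : height w = sumn l.
  rewrite -(sum_nth_sumn l0) (reindex_inj rev_ord_inj); apply: eq_bigr => i _.
  by rewrite -shapeE -shape_rev.
have chE := chains_height heightE; rewrite shapeE in chE.
have ch_gt0 : (0 < chains w (sumn l))%N.
  rewrite chE; apply: nsyt_gt0 => //; last exact: sum_nth_sumn.
  exact/sorted_geqP.
have [sP lcP] := poly_of_binomials ch_gt0; set P := \sum_(k < _) _ in sP lcP.
have PE m : P.[m%:R] = (size (stds (below w) m))%:R.
  (* Both summation ranges may be used: binomials vanish beyond [m], chain counts beyond the
     height. *)
  rewrite size_stds_chains (@sum_ord_vanish (fun d => chains w d * 'C(m, d))%N m.+1 (sumn l).+1).
  - rewrite horner_sum natr_sum; apply: eq_bigr => k _.
    by rewrite hornerZ horner_binpoly natrM.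
  - by move=> d md; rewrite bin_small ?muln0.
  - by move=> d ld; rewrite chains_eq0 // heightE.
have HP m := hilbert_schubert m rk_w F_mono.
split=> [[Q [m0 Q_hilb] DE] | ->].
  have QP : Q = P.
    apply/eqP; rewrite -subr_eq0; apply/eqP; apply: (@poly_eq0_large m0.+1) => -[//|m] m0m.
    rewrite !hornerE.
    have [h hQ ->] := Q_hilb m.+1 (ltnW m0m).
    have -> : h = size (stds (below w) m.+1).
      by apply/eqP; rewrite eqn_leq (hilbert_function_leq hQ (HP m)) (hilbert_function_leq (HP m) hQ).
    by rewrite PE subrr.
  by move/eqP: DE; rewrite QP sP lcP -chE eqr_nat => /eqP.
exists P; last by rewrite sP lcP -chE.
(* The Hilbert function was computed in positive degrees, hence the threshold 1. *)
exists 1%N => -[//|m] _; exists (size (stds (below w) m.+1)); [exact: HP | exact: PE].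
Qed.

(** Any choice of Grassmannian and flag gives the same count, since empty rows do not affect [nsyt];
    a coordinate flag shows that a choice exists. *)
Lemma plucker_degree_nsyt (K : numFieldType) r d l : (0 < r)%N -> l \in partitions r d ->
  plucker_degree K l = nsyt r d (nth 0%N l).
Proof.
move=> r_gt0; rewrite mem_partitions => /and3P[/eqP szl sl /eqP <-].
have l0 i : (r <= i)%N -> nth 0%N l i = 0%N by move=> ri; rewrite nth_default ?szl.
apply: xget_unique => [|D [r' [n [F [[_ l0'] _ flagF degF]]]]]; last first.
  by rewrite (nsyt_bound _ l0 l0'); apply/(schubert_degree _ sl l0' flagF).
have decr_l i j : (i <= j)%N -> (nth 0 l j <= nth 0 l i)%N.
  move=> ij; rewrite -(subnK ij); elim: (j - i)%N => // k IHk.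
  by rewrite addSn; apply: leq_trans IHk; apply/sorted_geqP.
(* The least ambient dimension allowed by the first part of [l]. *)
pose n := (nth 0%N l 0 + r)%N.
pose F (i : 'I_r) : 'M[K]_n := pid_mx (i.+1 + nth 0%N l (r - i.+1)).
have rkF i : \rank (F i) = (i.+1 + nth 0%N l (r - i.+1))%N.
  by rewrite rank_pid_mx //; have := decr_l 0%N (r - i.+1)%N isT; have := ltn_ord i; rewrite /n; lia.
have flagF : is_flag l F.
  split=> // i j ij; rewrite ltmxErank !rkF.
  have le_l : (nth 0 l (r - i.+1) <= nth 0 l (r - j.+1))%N by apply: decr_l; lia.
  apply/andP; split; last by lia.
  (* Nested coordinate projections satisfy F_i F_j = F_i. *)
  apply/submxP; exists (F i); rewrite mul_pid_mx /F; congr pid_mx.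
  have := rank_leq_row (F i); rewrite rkF; lia.
exists r, n, F; split=> //; exact/(schubert_degree _ sl l0 flagF).
Qed.

(** * Powers of z_1 + ... + z_r and the exponential series *)

Theorem corollary3p5 (R : realType) (r : nat) (hr : (0 < r)%N) :
  (series_egf (fun d : nat =>
     \sum_(l <- partitions r d) (plucker_degree R[i] l)%:R * schur r l)
   =1 series_exp (series_linear (\sum_(i < r) z i)))
  /\
  (forall d : nat,
     (\sum_(i < r) z i) ^+ d
     = \sum_(l <- partitions r d) (plucker_degree R[i] l)%:R * schur r l).
Proof.
have main d : (\sum_(i < r) z i) ^+ d =
    \sum_(l <- partitions r d) (plucker_degree R[i] l)%:R * schur r l.
  rewrite schur_expansion big_seq [RHS]big_seq; apply: eq_bigr => l lP.
  by rewrite (plucker_degree_nsyt _ hr lP).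
by split=> // d; rewrite series_exp_linear main.
Qed.
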